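(* Let $(M,g)$ be a Riemannian $n$-manifold and let $k$ be given. Then $(M,g)$ admits a local isometric immersion in $\mathbb{R}^{n+k}$ if and only if there exists locally on $M$ a $k$-tuple of scalar fields $h^{(1)},\dots,h^{(k)}$ such that $$f_{ab}=g_{ab}-\sum_{\tau=1}^{k}h^{(\tau)}_{;a}h^{(\tau)}_{;b}$$ is a flat Riemannian metric.
   Context: All manifolds, metrics and functions are smooth. The subscript '';'' denotes covariant differentiation with respect to the Levi-Civita connection of $g$ (so $h_{;a}$ is the differential of the scalar $h$). ''Locally'' means: on some open neighbourhood of each point of $M$. A Riemannian $n$-manifold $(M,g)$ admits a local isometric immersion in $\mathbb{R}^{m}$ if there exists locally on $M$ an $m$-tuple of scalar fields $u^{(1)},\dots,u^{(m)}$ with $\sum_{\tau=1}^m u^{(\tau)}_{;a}u^{(\tau)}_{;b}=g_{ab}$. A flat Riemannian metric is a positive definite metric with vanishing curvature tensor. *)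

(* Defs.v *)
From mathcomp Require Import all_boot all_order all_algebra.
From mathcomp Require Import all_classical all_reals all_analysis.
Set Implicit Arguments.
Unset Strict Implicit.
Unset Printing Implicit Defensive.
Import Order.TTheory GRing.Theory Num.Theory.
Import numFieldNormedType.Exports.
Local Open Scope classical_set_scope.
Local Open Scope ring_scope.

Definition pderiv (R : realType) (n : nat) (a : 'I_n) (f : 'rV[R]_n -> R)
  (x : 'rV[R]_n) : R := 'D_(delta_mx 0 a) f x.

(* A function is C^(r+1) when it is (Frechet) differentiable and its
   derivative, given by the partial derivatives, is C^r.  The set U is meant
   to be open, so that only the values of f on U matter. *)
Fixpoint Cr_on (R : realType) (n r : nat) (U : set 'rV[R]_n)
    (f : 'rV[R]_n -> R) : Prop :=
  match r with
  | 0 => forall x, U x -> {for x, continuous f}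
  | r'.+1 => (forall x, U x -> differentiable f x) /\
             (forall a : 'I_n, Cr_on r' U (pderiv a f))
  end.

Definition smooth_on (R : realType) (n : nat) (U : set 'rV[R]_n)
  (f : 'rV[R]_n -> R) : Prop := forall r : nat, Cr_on r U f.

(* cmap and cinv are total functions; only their values on cdom and ccod
   are meaningful. *)
Record chart (R : realType) (n : nat) (M : topologicalType) := Chart {
  cdom : set M;
  ccod : set 'rV[R]_n;
  cmap : M -> 'rV[R]_n;
  cinv : 'rV[R]_n -> M;
  cdom_open : open cdom;
  ccod_open : open ccod;
  cmap_cod : forall p, cdom p -> ccod (cmap p);
  cinv_dom : forall x, ccod x -> cdom (cinv x);
  cmapK : forall p, cdom p -> cinv (cmap p) = p;
  cinvK : forall x, ccod x -> cmap (cinv x) = x;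
  cmap_continuous : forall p, cdom p -> {for p, continuous cmap};
  cinv_continuous : forall x, ccod x -> {for x, continuous cinv}
}.

(* The open subset of R^n onto which the chart maps W `&` cdom c, for W
   open. *)
Definition chart_image (R : realType) (n : nat) (M : topologicalType)
  (c : chart R n M) (W : set M) : set 'rV[R]_n :=
  ccod c `&` cinv c @^-1` W.

Definition transition (R : realType) (n : nat) (M : topologicalType)
  (c d : chart R n M) (k : 'I_n) (x : 'rV[R]_n) : R :=
  cmap d (cinv c x) 0 k.

(* A smooth structure is given by a (not necessarily maximal) smooth atlas,
   as an indexed family of charts. *)
Record manifold (R : realType) (n : nat) := Manifold {
  carrier :> topologicalType;
  carrier_hausdorff : hausdorff_space carrier;
  carrier_second_countable : @second_countable carrier;
  atlas_index : Type;
  atlas : atlas_index -> chart R n carrier;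
  atlas_cover : forall p, exists i, cdom (atlas i) p;
  atlas_smooth : forall i j k,
    smooth_on (chart_image (atlas i) (cdom (atlas j)))
      (transition (atlas i) (atlas j) k)
}.

Definition smooth_scalar_on (R : realType) (n : nat) (M : manifold R n)
  (W : set M) (u : M -> R) : Prop :=
  forall i, smooth_on (chart_image (atlas i) W) (u \o cinv (atlas i)).

(* The component u_{;a} of the differential of u in the i-th chart, at the
   point with coordinates x. *)
Definition dscalar (R : realType) (n : nat) (M : manifold R n) (u : M -> R)
  (i : atlas_index M) (x : 'rV[R]_n) (a : 'I_n) : R :=
  pderiv a (u \o cinv (atlas i)) x.

(* Components T_{ab} of a covariant field of rank 2: T i x is their matrix in
   the i-th chart, at the point with coordinates x. *)
Definition components2 (R : realType) (n : nat) (M : manifold R n) : Type :=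
  atlas_index M -> 'rV[R]_n -> 'M[R]_n.

Definition tensorial_on (R : realType) (n : nat) (M : manifold R n)
  (W : set M) (T : components2 M) : Prop :=
  forall (i j : atlas_index M) (x : 'rV[R]_n),
    chart_image (atlas i) (W `&` cdom (atlas j)) x ->
    forall a b : 'I_n,
      T i x a b =
      \sum_(k < n) \sum_(l < n)
        T j (cmap (atlas j) (cinv (atlas i) x)) k l
        * pderiv a (transition (atlas i) (atlas j) k) x
        * pderiv b (transition (atlas i) (atlas j) l) x.

Definition riemannian_metric_on (R : realType) (n : nat) (M : manifold R n)
  (W : set M) (g : components2 M) : Prop :=
  [/\ tensorial_on W g,
      forall i a b, smooth_on (chart_image (atlas i) W) (fun x => g i x a b),
      forall i x, chart_image (atlas i) W x ->
        forall a b, g i x a b = g i x b a &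
      forall i x, chart_image (atlas i) W x ->
        forall v : 'rV[R]_n, v != 0 ->
          0 < \sum_(a < n) \sum_(b < n) g i x a b * v 0 a * v 0 b].

(* Gamma^a_{bc} of the Levi-Civita connection of the metric G. *)
Definition christoffel (R : realType) (n : nat) (G : 'rV[R]_n -> 'M[R]_n)
  (a b c : 'I_n) (x : 'rV[R]_n) : R :=
  2^-1 * \sum_(d < n) invmx (G x) a d *
    (pderiv b (fun y => G y d c) x + pderiv c (fun y => G y d b) x
     - pderiv d (fun y => G y b c) x).

(* R^a_{bcd} = d_c Gamma^a_{db} - d_d Gamma^a_{cb}
             + Gamma^a_{ce} Gamma^e_{db} - Gamma^a_{de} Gamma^e_{cb}. *)
Definition curvature (R : realType) (n : nat) (G : 'rV[R]_n -> 'M[R]_n)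
  (a b c d : 'I_n) (x : 'rV[R]_n) : R :=
  pderiv c (christoffel G a d b) x - pderiv d (christoffel G a c b) x
  + \sum_(e < n) (christoffel G a c e x * christoffel G e d b x
                  - christoffel G a d e x * christoffel G e c b x).

Definition flat_on (R : realType) (n : nat) (M : manifold R n)
  (W : set M) (g : components2 M) : Prop :=
  forall i x, chart_image (atlas i) W x ->
    forall a b c d : 'I_n, curvature (g i) a b c d x = 0.

Definition flat_riemannian_metric_on (R : realType) (n : nat)
  (M : manifold R n) (W : set M) (g : components2 M) : Prop :=
  riemannian_metric_on W g /\ flat_on W g.

Definition local_isometric_immersion (R : realType) (n : nat)
  (M : manifold R n) (g : components2 M) (m : nat) : Prop :=
  forall p : M, exists W : set M, [/\ open W, W p &
    exists u : 'I_m -> M -> R,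
      (forall t, smooth_scalar_on W (u t)) /\
      (forall i x, chart_image (atlas i) W x -> forall a b : 'I_n,
         \sum_(t < m) dscalar (u t) i x a * dscalar (u t) i x b
         = g i x a b)].

(* Main.v *)
From HB Require Import structures.
Require Import Defs.
From mathcomp Require Import all_boot all_order all_algebra.
From mathcomp Require Import all_classical all_reals all_analysis.
From mathcomp Require Import ring lra.
Import Order.TTheory GRing.Theory Num.Theory.
Import numFieldNormedType.Exports.
Set Implicit Arguments.
Unset Strict Implicit.
Unset Printing Implicit Defensive.
Local Open Scope classical_set_scope.
Local Open Scope ring_scope.

(** If [u] is a local isometric immersion into R^(n+k), then [n] of its components
    have independent differentials at a given point, since the sum of the squares
    of all the differentials is the nondegenerate form [g]. Take the other [k]
    components for [h]: what they leave of [g] is the sum of the squares of the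
    [n] independent differentials, that is, a Euclidean metric in curvilinear
    coordinates. It is positive definite, and flat ([gram_flat]): with J the
    jacobian matrix of the chosen components, [christoffel_gram] says that
    J Gamma is the matrix of second derivatives, and the symmetry of third
    derivatives gives J R = 0. This is a computation in any chart
    where J is invertible.

    Conversely, if f = g - sum dh dh is a flat Riemannian metric, it suffices to
    find [n] functions [v] near a given point with sum dv dv = f
    ([flat_coordinates]); the components of the immersion are then [v] and [h].
    Each [v] solves the linear total differential system

      d_b v = w_b,    d_b w_c = Gamma^a_bc w_a,

    whose integrability conditions are the symmetry of Gamma and the vanishing of
    the curvature. The initial values of the [n] covectors w form an orthonormal
    coframe ([gram_exists]). The products of parallel covectors obey the same
    linear system as f, so they agree with f near the point ([vanish_near]).

    The analytic core is the solution of integrable linear systems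
    d_b y = A_b y ([frobenius]). The value at [x] is obtained by solving an
    ordinary differential equation along the ray from the base point to [x],
    which Picard iteration does on a small ball ([linear_ode]). Comparing the
    rays to [x] and to [x + h] by a Gronwall inequality ([half_growth_bound])
    shows directly that the difference is A_b(x) h^b y(x) up to O(|h|^2), so [y]
    is differentiable and solves the system. It is then smooth because its
    derivatives are linear in [y] ([solves_smooth]). *)

(** * Partial derivatives of Frechet differentiable functions *)

Lemma continuous_at_sum (R : realType) (T : topologicalType) (I : Type)
    (r : seq I) (P : pred I) (F : I -> T -> R) (x : T) :
  (forall i, continuous_at x (F i)) ->
  continuous_at x (fun y => \sum_(i <- r | P i) F i y).
Proof.
move=> cF; elim: r => [|i r IH].
  under eq_fun do rewrite big_nil; exact: cvg_cst.
under eq_fun do rewrite big_cons.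
case: (P i) => //; apply: (@cvgD _ _ _ (nbhs x)); [exact: cF | exact: IH].
Qed.

Section PartialDerivatives.
Context {R : realType} {n : nat}.
Implicit Types (f g : 'rV[R]_n -> R) (x v : 'rV[R]_n) (U : set 'rV[R]_n).

Lemma derive_pderiv f x v : differentiable f x ->
  'D_v f x = \sum_k v 0 k * pderiv k f x.
Proof.
move=> df; rewrite deriveE // {1}(row_sum_delta v) linear_sum /=.
by apply: eq_bigr => k _; rewrite linearZ /= /pderiv deriveE.
Qed.

Lemma is_derive_line f x v (t : R) : differentiable f (x + t *: v) ->
  is_derive t 1 (fun s => f (x + s *: v))
    (\sum_k v 0 k * pderiv k f (x + t *: v)).
Proof.
move=> df; rewrite -derive_pderiv // deriveE //.
pose l (s : R) := x + s *: v.
have dl : is_diff t l (fun s => s *: v).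
  by apply: is_diff_eq; rewrite add0r.
have dl' : differentiable l t by exact: ex_diff.
have dfl : differentiable (f \o l) t by exact: differentiable_comp.
apply: DeriveDef; first exact/diff_derivable.
rewrite deriveE //= (diff_comp dl' df) /=.
by rewrite [X in 'd f _ (X 1)]diff_val scale1r.
Qed.

(** The remainder is estimated instead of being named as a little-o, so that an
    explicit inequality yields the differential; conversely for
    [near0_differentiable]. *)
Lemma differentiable_near0 f x (c : 'I_n -> R) :
  (forall e, 0 < e -> \forall h \near (0 : 'rV[R]_n),
     `|f (h + x) - f x - \sum_k h 0 k * c k| <= e * `|h|) ->
  differentiable f x /\ forall k, pderiv k f x = c k.
Proof.
move=> H.
pose L (h : 'rV[R]_n) := \sum_k h 0 k * c k.
have Llin : linear L.
  move=> a u v; rewrite /L scaler_sumr -big_split; apply: eq_bigr => k _ /=.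
  by rewrite !mxE /GRing.scale/= mulrDl mulrA.
pose LM := GRing.isLinear.Build _ _ _ _ _ Llin.
pose Lf : {linear 'rV[R]_n -> R} := HB.pack L LM.
have Lc : continuous Lf.
  move=> y; rewrite /Lf /= /L.
  apply: (@continuous_at_sum _ _ _ _ _ (fun k (h : 'rV[R]_n) => h 0 k * c k)) => k.
  apply: (@cvgMr_tmp _ _ (nbhs y) _ (fun h : 'rV[R]_n => h 0 k) (y 0 k) (c k)); exact: (@coord_continuous R 1 n 0 k y).
have E : f \o shift x = cst (f x) + (Lf : _ -> _) +o_ (0 : 'rV[R]_n) id.
  apply/eqaddoP => e e0; near=> h.
  rewrite /= opprD addrA; near: h; exact: H.
have dE := diff_unique Lc E.
have df : differentiable f x.
  by apply/diff_locallyP; rewrite dE.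
split=> // k; rewrite /pderiv deriveE // dE /= /L (bigD1 k) //= big1 => [|j jk].
  by rewrite mxE !eqxx mul1r addr0.
by rewrite mxE eqxx (negbTE jk) mul0r.
Unshelve. all: by end_near. Qed.

Lemma near0_differentiable f x : differentiable f x ->
  forall e, 0 < e -> \forall h \near (0 : 'rV[R]_n),
     `|f (h + x) - f x - \sum_k h 0 k * pderiv k f x| <= e * `|h|.
Proof.
move=> df e e0; have /eqaddoP/(_ e e0) := diff_locally df.
apply: filterS => h.
by rewrite -derive_pderiv // deriveE // -addrA -opprD.
Qed.

Lemma pderiv_near k f g x : (\near x, f x = g x) ->
  pderiv k f x = pderiv k g x.
Proof. exact: near_eq_derive. Qed.

Lemma differentiable_near f g x : (\near x, f x = g x) ->
  differentiable f x -> differentiable g x.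
Proof.
move=> fg df; have fgx := nbhs_singleton fg.
suff [] : differentiable g x /\ forall k, pderiv k g x = pderiv k f x by [].
apply: differentiable_near0 => e e0.
have fg0 : \forall h \near (0 : 'rV[R]_n), f (h + x) = g (h + x).
  by move: fg; rewrite (near_shift 0 x) /=; apply: filterS => h; rewrite subr0.
near=> h.
rewrite -fgx -(near fg0 h) //; near: h; exact: near0_differentiable.
Unshelve. all: by end_near. Qed.

Lemma pderiv_cst k (a : R) x : pderiv k (fun _ => a) x = 0.
Proof. exact: derive_cst. Qed.

Lemma pderivD k f g x : differentiable f x -> differentiable g x ->
  pderiv k (fun y => f y + g y) x = pderiv k f x + pderiv k g x.
Proof. by move=> df dg; apply: deriveD; exact: diff_derivable. Qed.

Lemma pderivB k f g x : differentiable f x -> differentiable g x ->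
  pderiv k (fun y => f y - g y) x = pderiv k f x - pderiv k g x.
Proof. by move=> df dg; apply: deriveB; exact: diff_derivable. Qed.

Lemma pderivM k f g x : differentiable f x -> differentiable g x ->
  pderiv k (fun y => f y * g y) x = pderiv k f x * g x + f x * pderiv k g x.
Proof.
move=> df dg.
rewrite {1}/pderiv (_ : 'D__ _ x = 'D_(delta_mx 0 k) (f * g) x) //.
rewrite deriveM; [|exact: diff_derivable..].
by rewrite addrC /GRing.scale /= [g x * _]mulrC.
Qed.

Lemma pderivV k f x : differentiable f x -> f x != 0 ->
  pderiv k (fun y => (f y)^-1) x = - pderiv k f x * ((f x)^-1 * (f x)^-1).
Proof.
move=> df fx; rewrite {1}/pderiv; have fd : derivable f x (delta_mx 0 k) by exact: diff_derivable.
rewrite (deriveV fx fd).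
by rewrite /GRing.scale /= expr2 invfM mulNr mulrC mulNr.
Qed.

Lemma diff_sum (I : Type) (r : seq I) (P : pred I) (F : I -> 'rV[R]_n -> R) x :
  (forall i, differentiable (F i) x) ->
  differentiable (fun y => \sum_(i <- r | P i) F i y) x.
Proof.
move=> dF; elim: r => [|i r IH].
  have -> : (fun y => \sum_(j <- [::] | P j) F j y) = cst 0.
    by apply/funext => y; rewrite big_nil.
  exact: differentiable_cst.
under eq_fun do rewrite big_cons.
by case: (P i) => //; exact: differentiableD.
Qed.

Lemma pderiv_sum k (I : Type) (r : seq I) (P : pred I)
    (F : I -> 'rV[R]_n -> R) x : (forall i, differentiable (F i) x) ->
  pderiv k (fun y => \sum_(i <- r | P i) F i y) x =
  \sum_(i <- r | P i) pderiv k (F i) x.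
Proof.
move=> dF; elim: r => [|i r IH].
  rewrite big_nil.
  have -> : (fun y => \sum_(j <- [::] | P j) F j y) = (fun=> 0).
    by apply/funext => y; rewrite big_nil.
  exact: pderiv_cst.
under eq_fun do rewrite big_cons; rewrite big_cons.
by case: (P i) => //; rewrite pderivD // ?IH //; exact: diff_sum.
Qed.

End PartialDerivatives.

(** * Smooth functions and the chain rule *)

Lemma near_open (T : topologicalType) (U : set T) (P : T -> Prop) x :
  open U -> U x -> (forall y, U y -> P y) -> \forall y \near x, P y.
Proof. by move=> oU Ux UP; exact: filterS UP (open_nbhs_nbhs (conj oU Ux)). Qed.

Section SmoothFunctions.
Context {R : realType} {n : nat}.
Implicit Types (f g : 'rV[R]_n -> R) (x v : 'rV[R]_n) (U V : set 'rV[R]_n).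

Lemma Cr_on_sub r U V f : V `<=` U -> Cr_on r U f -> Cr_on r V f.
Proof.
move=> VU; elim: r f => [f cf x /VU/cf //|r IH f [df pf]].
by split=> [x /VU/df //|a]; exact: IH (pf a).
Qed.

Lemma Cr_on_ext r U f g : open U -> (forall x, U x -> f x = g x) ->
  Cr_on r U f -> Cr_on r U g.
Proof.
move=> oU; elim: r f g => [|r IH] f g fg.
  move=> cf x Ux; have fgx := fg _ Ux.
  have nfg : \forall y \near x, f y = g y by exact: near_open oU Ux fg.
  rewrite /prop_for /continuous_at -fgx.
  exact: cvg_trans (near_eq_cvg nfg) (cf x Ux).
have nfg x (Ux : U x) : \near x, f x = g x by exact: near_open oU Ux fg.
move=> [df pf]; split=> [x Ux|a].
  exact: differentiable_near (nfg x Ux) (df x Ux).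
by apply: IH (pf a) => x Ux; exact/pderiv_near/nfg.
Qed.

Lemma Cr_onW r U f : Cr_on r.+1 U f -> Cr_on r U f.
Proof.
elim: r f => [f [df _] x Ux|r IH f [df pf]].
  exact/differentiable_continuous/df.
by split=> // a; apply: IH; exact: pf.
Qed.

Lemma Cr_on_cst r U (a : R) : Cr_on r U (fun=> a).
Proof.
elim: r a => [a x _|r IH a]; first exact: cst_continuous.
split=> [x _|b]; first exact: differentiable_cst.
have -> : pderiv b (fun=> a) = (fun=> 0); last exact: IH.
by apply/funext => x; rewrite pderiv_cst.
Qed.

Lemma Cr_onD r U f g : open U -> Cr_on r U f -> Cr_on r U g ->
  Cr_on r U (fun x => f x + g x).
Proof.
move=> oU; elim: r f g => [f g cf cg x Ux|r IH f g [df pf] [dg pg]].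
  by apply: (@cvgD _ _ _ (nbhs x)); [exact: cf | exact: cg].
split=> [x Ux|a]; first exact: differentiableD (df x Ux) (dg x Ux).
apply: Cr_on_ext (IH _ _ (pf a) (pg a)) => // x Ux.
by rewrite pderivD; [|exact: df|exact: dg].
Qed.

Lemma Cr_onM r U f g : open U -> Cr_on r U f -> Cr_on r U g ->
  Cr_on r U (fun x => f x * g x).
Proof.
move=> oU; elim: r f g => [f g cf cg x Ux|r IH f g Cf Cg].
  by apply: (@cvgM _ _ (nbhs x)); [exact: cf | exact: cg].
have [[df pf] [dg pg]] := (Cf, Cg).
split=> [x Ux|a]; first exact: differentiableM (df x Ux) (dg x Ux).
have := Cr_onD oU (IH _ _ (pf a) (Cr_onW Cg)) (IH _ _ (Cr_onW Cf) (pg a)).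
apply: Cr_on_ext => // x Ux.
by rewrite pderivM; [|exact: df|exact: dg].
Qed.

Lemma Cr_on_sum r U (I : Type) (s : seq I) (P : pred I)
    (F : I -> 'rV[R]_n -> R) : open U ->
  (forall i, Cr_on r U (F i)) -> Cr_on r U (fun x => \sum_(i <- s | P i) F i x).
Proof.
move=> oU CF; elim: s => [|i s IH].
  under eq_fun do rewrite big_nil; exact: Cr_on_cst.
under eq_fun do rewrite big_cons.
by case: (P i) => //; exact: Cr_onD.
Qed.

Lemma Cr_on_prod r U (I : Type) (s : seq I) (P : pred I)
    (F : I -> 'rV[R]_n -> R) : open U ->
  (forall i, Cr_on r U (F i)) -> Cr_on r U (fun x => \prod_(i <- s | P i) F i x).
Proof.
move=> oU CF; elim: s => [|i s IH].
  under eq_fun do rewrite big_nil; exact: Cr_on_cst.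
under eq_fun do rewrite big_cons.
by case: (P i) => //; exact: Cr_onM.
Qed.

Lemma Cr_onV r U f : open U -> (forall x, U x -> f x != 0) ->
  Cr_on r U f -> Cr_on r U (fun x => (f x)^-1).
Proof.
move=> oU f0; elim: r => [cf x Ux|r IH Cf].
  by apply: (@cvgV _ _ (nbhs x) _ f (f x)); [exact: f0 | exact: cf].
have [df pf] := Cf; have Cinv := IH (Cr_onW Cf).
split=> [x Ux|a]; first exact: differentiableV (df x Ux) (f0 x Ux).
have := Cr_onM oU (Cr_onM oU (Cr_on_cst r U (-1)) (pf a)) (Cr_onM oU Cinv Cinv).
apply: Cr_on_ext => // x Ux.
by rewrite pderivV ?mulN1r; [|exact: df|exact: f0].
Qed.

Section Smooth.
Variables (U : set 'rV[R]_n) (oU : open U).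

Lemma smooth_ext f g : (forall x, U x -> f x = g x) ->
  smooth_on U f -> smooth_on U g.
Proof. by move=> fg sf r; exact: Cr_on_ext (sf r). Qed.

Lemma smooth_diff f x : smooth_on U f -> U x -> differentiable f x.
Proof. by move=> sf; have [df _] := sf 1%N; exact: df. Qed.

Lemma smooth_pderiv f a : smooth_on U f -> smooth_on U (pderiv a f).
Proof. by move=> sf r; have [_] := sf r.+1; exact. Qed.

Lemma smooth_cst (a : R) : smooth_on U (fun=> a).
Proof. by move=> r; exact: Cr_on_cst. Qed.

Lemma smoothD f g : smooth_on U f -> smooth_on U g ->
  smooth_on U (fun x => f x + g x).
Proof. by move=> sf sg r; exact: Cr_onD. Qed.

Lemma smoothM f g : smooth_on U f -> smooth_on U g ->
  smooth_on U (fun x => f x * g x).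
Proof. by move=> sf sg r; exact: Cr_onM. Qed.

Lemma smoothB f g : smooth_on U f -> smooth_on U g ->
  smooth_on U (fun x => f x - g x).
Proof.
move=> sf sg; apply: smoothD => //.
under eq_fun do rewrite -mulN1r; exact/smoothM/sg/smooth_cst.
Qed.

Lemma smooth_sum (I : Type) (s : seq I) (P : pred I) (F : I -> 'rV[R]_n -> R) :
  (forall i, smooth_on U (F i)) ->
  smooth_on U (fun x => \sum_(i <- s | P i) F i x).
Proof. by move=> sF r; apply: Cr_on_sum => // i; exact: sF. Qed.

Lemma smooth_prod (I : Type) (s : seq I) (P : pred I) (F : I -> 'rV[R]_n -> R) :
  (forall i, smooth_on U (F i)) ->
  smooth_on U (fun x => \prod_(i <- s | P i) F i x).
Proof. by move=> sF r; apply: Cr_on_prod => // i; exact: sF. Qed.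

Lemma smoothV f : (forall x, U x -> f x != 0) -> smooth_on U f ->
  smooth_on U (fun x => (f x)^-1).
Proof. by move=> f0 sf r; exact: Cr_onV. Qed.

Lemma smooth_det m (A : 'rV[R]_n -> 'M[R]_m) :
  (forall i j, smooth_on U (fun x => A x i j)) ->
  smooth_on U (fun x => \det (A x)).
Proof.
move=> sA; rewrite /determinant; apply: smooth_sum => s.
by apply: smoothM; [exact: smooth_cst|exact: smooth_prod].
Qed.

(** By Cramer's rule the entries are rational in those of [A]. *)
Lemma smooth_invmx m (A : 'rV[R]_n -> 'M[R]_m) :
  (forall x, U x -> A x \in unitmx) ->
  (forall i j, smooth_on U (fun x => A x i j)) ->
  forall i j, smooth_on U (fun x => invmx (A x) i j).
Proof.
move=> uA sA i j.
apply: (@smooth_ext (fun x => (\det (A x))^-1 * cofactor (A x) j i)) => [x Ux|].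
  by rewrite /invmx uA // !mxE.
apply: smoothM.
  apply: smoothV; last exact: smooth_det.
  by move=> x Ux; rewrite -unitfE -unitmxE uA.
apply: smoothM; first exact: smooth_cst.
apply: smooth_det => k l.
under eq_fun do rewrite !mxE; exact: sA.
Qed.

End Smooth.

Lemma smooth_sub U V f : V `<=` U -> smooth_on U f -> smooth_on V f.
Proof. by move=> VU sf r; exact: Cr_on_sub (sf r). Qed.

End SmoothFunctions.

Section ChainRule.
Context {R : realType} {m n : nat}.
Implicit Types (f : 'rV[R]_n -> R) (Phi : 'rV[R]_m -> 'rV[R]_n) (x : 'rV[R]_m).

Lemma differentiable_coords Phi x :
  (forall k, differentiable (fun y => Phi y 0 k) x) -> differentiable Phi x.
Proof.
move=> dP.
have -> : Phi = \sum_k (fun y => Phi y 0 k *: (delta_mx 0 k : 'rV[R]_n)).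
  by apply/funext => y; rewrite {1}(row_sum_delta (Phi y)) fct_sumE.
by apply: differentiable_sum => k; exact: differentiableZl.
Qed.

Lemma differentiable_compr f Phi x :
  (forall k, differentiable (fun y => Phi y 0 k) x) ->
  differentiable f (Phi x) -> differentiable (f \o Phi) x.
Proof. by move=> /differentiable_coords dP df; exact: differentiable_comp. Qed.

Lemma pderiv_comp f Phi x a :
  (forall k, differentiable (fun y => Phi y 0 k) x) ->
  differentiable f (Phi x) ->
  pderiv a (f \o Phi) x =
  \sum_k pderiv k f (Phi x) * pderiv a (fun y => Phi y 0 k) x.
Proof.
move=> dPk df; have dP := differentiable_coords dPk.
rewrite {1}/pderiv deriveE; last exact: differentiable_comp.
rewrite (diff_comp dP df) /= -deriveE // derive_pderiv //.
apply: eq_bigr => k _; rewrite mulrC; congr (_ * _).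
by rewrite -deriveE // derive_mx ?mxE //; exact: diff_derivable.
Qed.

Lemma smooth_comp (U : set 'rV[R]_m) (V : set 'rV[R]_n) f Phi :
  open U -> (forall x, U x -> V (Phi x)) ->
  smooth_on V f -> (forall k, smooth_on U (fun y => Phi y 0 k)) ->
  smooth_on U (f \o Phi).
Proof.
move=> oU UV sf sP r; elim: r f sf => [|r IH] f sf.
  move=> x Ux; apply/differentiable_continuous/differentiable_compr.
    by move=> k; exact: smooth_diff (sP k) Ux.
  by apply: smooth_diff sf _; exact: UV.
split=> [x Ux|a].
  apply: differentiable_compr => [k|]; first exact: smooth_diff (sP k) Ux.
  by apply: smooth_diff sf _; exact: UV.
have : Cr_on r U (fun x => \sum_k (pderiv k f \o Phi) x *
                            pderiv a (fun y => Phi y 0 k) x).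
  apply: Cr_on_sum => // k; apply: Cr_onM => //.
    by apply: IH; exact: smooth_pderiv.
  exact: smooth_pderiv.
apply: Cr_on_ext => // x Ux; rewrite pderiv_comp //.
  by move=> k; exact: smooth_diff (sP k) Ux.
by apply: smooth_diff sf _; exact: UV.
Qed.

End ChainRule.

(** * Mean values, mixed derivatives and uniform remainders *)

Section MatrixNorm.
Context {R : realType}.

Lemma entry_le_norm m n (A : 'M[R]_(m, n)) i j : `|A i j| <= `|A|.
Proof. by rewrite [leRHS]/Num.Def.normr /= mx_normrE; apply: (le_bigmax _ _ (i, j)). Qed.

Lemma norm_le_entry m n (A : 'M[R]_(m, n)) e :
  0 <= e -> (forall i j, `|A i j| <= e) -> `|A| <= e.
Proof.
move=> e0 Ae; rewrite [leLHS]/Num.Def.normr /= mx_normrE.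
by apply: bigmax_le => // -[i k] _ /=.
Qed.

Lemma norm_mulmx m n p (A : 'M[R]_(m, n)) (B : 'M[R]_(n, p)) :
  `|A *m B| <= n%:R * `|A| * `|B|.
Proof.
apply: norm_le_entry => [|i j]; first by rewrite !mulr_ge0.
rewrite mxE; apply: le_trans (ler_norm_sum _ _ _) _.
apply: (@le_trans _ _ (\sum_(k < n) `|A| * `|B|)).
  by apply: ler_sum => k _; rewrite normrM; apply: ler_pM => //; exact: entry_le_norm.
by rewrite sumr_const card_ord -[X in X <= _]mulr_natl mulrA.
Qed.

End MatrixNorm.

Section NormBounds.
Context {R : realType} {n : nat}.
Implicit Types v : 'rV[R]_n.

Lemma norm_delta_le1 (k : 'I_n) : `|delta_mx 0 k : 'rV[R]_n| <= 1.
Proof.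
apply: norm_le_entry => // i j; rewrite ord1 mxE eqxx /=.
by case: eqP; rewrite ?normr1 ?normr0.
Qed.

Lemma sum_coord_le v (c : 'I_n -> R) M : (forall k, `|c k| <= M) ->
  `|\sum_k v 0 k * c k| <= n%:R * M * `|v|.
Proof.
move=> cM; apply: le_trans (ler_norm_sum _ _ _) _.
apply: (@le_trans _ _ (\sum_(k < n) M * `|v|)).
  apply: ler_sum => k _; rewrite normrM mulrC.
  by apply: ler_pM => //; exact: entry_le_norm.
by rewrite sumr_const card_ord -[X in X <= _]mulr_natl mulrA.
Qed.

Lemma ball_segment (x0 y h : 'rV[R]_n) r t : 0 <= t <= 1 ->
  `|y - x0| < r -> `|y + h - x0| < r -> `|y + t *: h - x0| < r.
Proof.
move=> /andP[t0 t1] yr yhr.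
have -> : y + t *: h - x0 = (1 - t) *: (y - x0) + t *: (y + h - x0).
  by apply/matrixP => i j; rewrite !mxE; ring.
apply: le_lt_trans (ler_normD _ _) _.
rewrite !normrZ [`|t|]ger0_norm // ger0_norm ?subr_ge0 //.
have [->|tn0] := eqVneq t 0; first by rewrite mul0r addr0 subr0 mul1r.
have tp : 0 < t by rewrite lt_neqAle eq_sym tn0.
have h1 : t * `|y + h - x0| < t * r by rewrite ltr_pM2l.
have h2 : (1 - t) * `|y - x0| <= (1 - t) * r.
  by rewrite ler_wpM2l ?subr_ge0 // ltW.
lra.
Qed.

End NormBounds.

Lemma open_norm_ball {R : realType} {n : nat} (x0 : 'rV[R]_n) r :
  open [set x : 'rV[R]_n | `|x - x0| < r].
Proof.
have -> : [set x : 'rV[R]_n | `|x - x0| < r] = ball x0 r.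
  by apply/seteqP; split=> x /=; rewrite -ball_normE /= distrC.
exact: ball_open.
Qed.

Section MeanValue.
Context {R : realType} {n : nat}.
Implicit Types (f : 'rV[R]_n -> R) (x v : 'rV[R]_n) (U : set 'rV[R]_n).

Lemma MVT_line f x v t : 0 < t ->
  (forall s, 0 <= s <= t -> differentiable f (x + s *: v)) ->
  exists2 c, 0 < c < t &
    f (x + t *: v) - f x = t * \sum_k v 0 k * pderiv k f (x + c *: v).
Proof.
move=> t0 df.
have [||c] := @MVT R (fun s => f (x + s *: v))
    (fun s => \sum_k v 0 k * pderiv k f (x + s *: v)) 0 t t0.
- move=> s; rewrite in_itv /= => /andP[s0 st].
  by apply: is_derive_line; apply: df; rewrite !ltW.
- apply: derivable_within_continuous => s; rewrite in_itv /= => st.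
  exact: (@ex_derive _ _ _ _ _ _ _ (is_derive_line (df s st))).
rewrite in_itv /= subr0 scale0r addr0 => ct ->; exists c => //.
by rewrite mulrC.
Qed.

Lemma sum_delta k (c : 'I_n -> R) : \sum_j (delta_mx 0 k : 'rV[R]_n) 0 j * c j = c k.
Proof.
rewrite (bigD1 k) //= big1 => [|j jk]; first by rewrite mxE !eqxx mul1r addr0.
by rewrite mxE eqxx (negbTE jk) mul0r.
Qed.

(** The mean value theorem applied in the direction [a] to the increment of [f]
    in the direction [b], then in the direction [b] to a partial derivative. *)
Lemma second_difference U f x a b t : 0 < t -> smooth_on U f ->
  (forall h k, 0 <= h <= t -> 0 <= k <= t ->
     U (x + h *: delta_mx 0 a + k *: delta_mx 0 b)) ->
  exists h k, [/\ 0 < h < t, 0 < k < t &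
    f (x + t *: delta_mx 0 a + t *: delta_mx 0 b) - f (x + t *: delta_mx 0 a)
      - (f (x + t *: delta_mx 0 b) - f x) =
    t ^+ 2 * pderiv b (pderiv a f) (x + h *: delta_mx 0 a + k *: delta_mx 0 b)].
Proof.
move=> t0 sf Ut.
pose ea : 'rV[R]_n := delta_mx 0 a; pose eb : 'rV[R]_n := delta_mx 0 b.
have tt : 0 <= t <= t by rewrite lexx ltW.
have zt : 0 <= (0 : R) <= t by rewrite lexx ltW.
pose g y := f (t *: eb + y) - f y.
have dg s : 0 <= s <= t -> is_derive s 1 (fun s => g (x + s *: ea))
   (pderiv a f (x + s *: ea + t *: eb) - pderiv a f (x + s *: ea)).
  move=> st.
  have U1 : U (x + t *: eb + s *: ea) by rewrite addrAC; exact: Ut.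
  have U2 : U (x + s *: ea) by have := Ut s 0 st zt; rewrite scale0r addr0.
  have d1 := is_derive_line (smooth_diff sf U1).
  have d2 := is_derive_line (smooth_diff sf U2).
  rewrite sum_delta in d1; rewrite sum_delta in d2.
  have e : (fun s0 => g (x + s0 *: ea)) =
     (fun s0 => f (x + t *: eb + s0 *: ea)) - (fun s0 => f (x + s0 *: ea)).
    by apply/funext => s0; rewrite /g addrA [t *: eb + x]addrC.
  by rewrite e [x + s *: ea + t *: eb]addrAC; exact: is_deriveB.
have [||h] := @MVT R (fun s => g (x + s *: ea)) (fun s =>
    pderiv a f (x + s *: ea + t *: eb) - pderiv a f (x + s *: ea)) 0 t t0.
- by move=> s; rewrite in_itv /= => /andP[s0 st]; apply: dg; rewrite !ltW.
- apply: derivable_within_continuous => s; rewrite in_itv /= => st.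
  exact: (@ex_derive _ _ _ _ _ _ _ (dg s st)).
rewrite in_itv /= subr0 scale0r addr0 => ht E.
have ht' : 0 <= h <= t by case/andP: ht => h0 h1; rewrite !ltW.
have [k kt E2] : exists2 c, 0 < c < t &
    pderiv a f (x + h *: ea + t *: eb) - pderiv a f (x + h *: ea) =
    t * \sum_j eb 0 j * pderiv j (pderiv a f) (x + h *: ea + c *: eb).
  apply: MVT_line => // s st; apply: smooth_diff (Ut _ _ ht' st).
  exact: smooth_pderiv.
exists h, k; split => //.
rewrite sum_delta in E2; rewrite E2 /g in E.
by rewrite expr2 -mulrA [RHS]mulrC -E addrC [t *: eb + _]addrC [t *: eb + x]addrC addrC.
Qed.

(** Schwarz: both iterated derivatives are limits of the same second
    difference. *)
Lemma pderivC U f x a b : open U -> smooth_on U f -> U x ->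
  pderiv a (pderiv b f) x = pderiv b (pderiv a f) x.
Proof.
move=> oU sf Ux; apply/eqP; rewrite -subr_eq0 -normr_le0.
apply/ler_addgt0Pr => e e0; rewrite add0r.
have e20 : 0 < e / 2 by rewrite divr_gt0.
have cab c d : \forall y \near x,
    `|pderiv c (pderiv d f) x - pderiv c (pderiv d f) y| < e / 2.
  have : {for x, continuous (pderiv c (pderiv d f))}.
    by apply: (smooth_pderiv c (smooth_pderiv d sf) 0%N).
  by move=> /cvgrPdist_lt; exact.
have /nbhs_ballP[r r0 rP] : \forall y \near x, [/\ U y,
    `|pderiv a (pderiv b f) x - pderiv a (pderiv b f) y| < e / 2 &
    `|pderiv b (pderiv a f) x - pderiv b (pderiv a f) y| < e / 2].
  exact: filterS3 (open_nbhs_nbhs (conj oU Ux)) (cab a b) (cab b a).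
pose t := r / 4.
have r0' : 0 < r by [].
have t0 : 0 < t by rewrite divr_gt0.
have inball c d h k : 0 <= h <= t -> 0 <= k <= t ->
    ball x r (x + h *: delta_mx 0 c + k *: delta_mx 0 d).
  move=> /andP[h0 ht] /andP[k0 kt].
  rewrite -ball_normE /= -addrA opprD addrA subrr sub0r normrN.
  apply: le_lt_trans (ler_normD _ _) _.
  rewrite !normrZ !ger0_norm //.
  have h1 : h * `|delta_mx 0 c : 'rV[R]_n| <= h.
    by rewrite ler_piMr // norm_delta_le1.
  have k1 : k * `|delta_mx 0 d : 'rV[R]_n| <= k.
    by rewrite ler_piMr // norm_delta_le1.
  by rewrite /t in ht kt; lra.
have [h [k [ht kt E1]]] := @second_difference U f x a b t t0 sf
   (fun h k ht kt => let: And3 u _ _ := rP _ (inball a b h k ht kt) in u).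
have [h' [k' [ht' kt' E2]]] := @second_difference U f x b a t t0 sf
   (fun h k ht kt => let: And3 u _ _ := rP _ (inball b a h k ht kt) in u).
have W s : 0 < s < t -> 0 <= s <= t by case/andP => ? ?; rewrite !ltW.
have [_ _ B1] := rP _ (inball a b h k (W _ ht) (W _ kt)).
have [_ B2 _] := rP _ (inball b a h' k' (W _ ht') (W _ kt')).
have : t ^+ 2 * pderiv b (pderiv a f) (x + h *: delta_mx 0 a + k *: delta_mx 0 b)
  = t ^+ 2 * pderiv a (pderiv b f) (x + h' *: delta_mx 0 b + k' *: delta_mx 0 a).
  apply: etrans (esym E1) (etrans _ E2).
  have sw (p q u w : R) : p - q - (u - w) = p - u - (q - w) by ring.
  by rewrite sw [x + t *: delta_mx 0 b + _]addrAC.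
move=> /(mulfI (lt0r_neq0 (exprn_gt0 2 t0))) E.
rewrite -E in B2.
apply: le_trans (ler_distD _ _ _) _.
rewrite [e]splitr; apply: lerD; first exact: ltW B2.
by rewrite distrC; exact: ltW B1.
Qed.

Section Local.
Variables (U : set 'rV[R]_n) (x0 : 'rV[R]_n).
Hypotheses (oU : open U) (Ux0 : U x0).

(** In these local estimates one large number [M] serves both as the bound and,
    inverted, as the radius: finitely many estimates then combine as properties
    that hold near infinity. *)
Lemma near_ball_sub :
  \forall M \near +oo, forall y, `|y - x0| < M^-1 -> U y.
Proof.
have /nbhs_ballP[r r0 rP] := open_nbhs_nbhs (conj oU Ux0).
have r0' : 0 < r by [].
near=> M => y yM; apply: rP; rewrite -ball_normE /= distrC.
have M0 : 0 < M by near: M; exact: (nbhs_pinfty_gt (num_real _)).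
have rM : r^-1 < M by near: M; exact: (nbhs_pinfty_gt (num_real _)).
by apply: lt_trans yM _; rewrite invf_plt.
Unshelve. all: by end_near. Qed.

Lemma near_bounded f : {for x0, continuous f} ->
  \forall M \near +oo, forall y, `|y - x0| < M^-1 -> `|f y| <= M.
Proof.
move=> /cvgrPdist_lt/(_ 1 ltr01)/nbhs_ballP[r r0 rP].
have r0' : 0 < r by [].
near=> M => y yM.
have M0 : 0 < M by near: M; exact: (nbhs_pinfty_gt (num_real _)).
have rM : r^-1 < M by near: M; exact: (nbhs_pinfty_gt (num_real _)).
have : `|f x0 - f y| < 1.
  apply: rP; rewrite -ball_normE /= distrC; apply: lt_trans yM _.
  by rewrite invf_plt.
have M1 : `|f x0| + 1 <= M by near: M; exact: (nbhs_pinfty_ge (num_real _)).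
rewrite distrC => fy; have := ler_normD (f y - f x0) (f x0); rewrite subrK.
lra.
Unshelve. all: by end_near. Qed.

(** The bound on the remainder is uniform in the base point, because the second
    derivatives are bounded near [x0]. *)
Lemma near_taylor f : smooth_on U f ->
  \forall M \near +oo, forall y h, `|y - x0| < M^-1 -> `|y + h - x0| < M^-1 ->
    `|f (y + h) - f y - \sum_k h 0 k * pderiv k f y| <= M * `|h| ^+ 2.
Proof.
move=> sf.
have HB : \forall M \near +oo, forall k j y, `|y - x0| < M^-1 ->
    `|pderiv j (pderiv k f) y| <= M.
  apply: filter_forall => k; apply: filter_forall => j.
  exact: near_bounded (smooth_pderiv j (smooth_pderiv k sf) 0%N x0 Ux0).
have [M1 [M10 MU MB]] : exists M, [/\ 0 < M,
    (forall y, `|y - x0| < M^-1 -> U y) &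
    (forall k j y, `|y - x0| < M^-1 -> `|pderiv j (pderiv k f) y| <= M)].
  apply: (@filter_ex _ (+oo : set_system R)); near=> M; split; near: M.
  - exact: (nbhs_pinfty_gt (num_real _)).
  - exact: near_ball_sub.
  - exact: HB.
near=> M => y h yM yhM.
have M1M : M^-1 <= M1^-1.
  have M0 : 0 < M by near: M; exact: (nbhs_pinfty_gt (num_real _)).
  have MM : M1 <= M by near: M; exact: (nbhs_pinfty_ge (num_real _)).
  by rewrite lef_pV2 ?posrE.
have seg t : 0 <= t <= 1 -> `|y + t *: h - x0| < M1^-1.
  by move=> t01; apply: ball_segment; rewrite ?(lt_le_trans _ M1M).
have [c /andP[c0 c1]] : exists2 c, 0 < c < 1 &
    f (y + 1 *: h) - f y = 1 * \sum_k h 0 k * pderiv k f (y + c *: h).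
  by apply: MVT_line => // s s01; exact: smooth_diff sf (MU _ (seg _ s01)).
rewrite scale1r mul1r => ->; rewrite -sumrB.
under eq_bigr do rewrite -mulrBr.
apply: le_trans (@sum_coord_le _ _ h _ (n%:R * M1 * `|h|) _) _ => [k|].
  have [d /andP[d0 dc] ->] : exists2 d, 0 < d < c &
      pderiv k f (y + c *: h) - pderiv k f y =
      c * \sum_j h 0 j * pderiv j (pderiv k f) (y + d *: h).
    apply: MVT_line => // s /andP[s0 sc]; apply: smooth_diff (MU _ (seg _ _)).
      exact: smooth_pderiv.
    by rewrite s0 (le_trans sc) // ltW.
  rewrite normrM gtr0_norm //.
  apply: le_trans (ler_piMl _ (ltW c1)) _ => //.
  apply: sum_coord_le => j; apply: MB; apply: seg.
  by rewrite !ltW // (lt_trans dc).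
have -> : n%:R * (n%:R * M1 * `|h|) * `|h| = n%:R * n%:R * M1 * `|h| ^+ 2 by ring.
have nM : n%:R * n%:R * M1 <= M by near: M; exact: (nbhs_pinfty_ge (num_real _)).
by apply: ler_wpM2r nM; rewrite exprn_ge0.
Unshelve. all: by end_near. Qed.

End Local.
End MeanValue.

(** * Linear ordinary differential equations *)

Section LinearODE.
Context {R : realType}.

(** The limit is the supremum of the lower estimates [u m - 2 C / 2 ^ m], which
    increase while the corresponding upper estimates decrease. *)
Lemma geometric_limit (u : nat -> R) C :
  (forall m, `|u m.+1 - u m| <= C / 2 ^+ m) ->
  exists l, forall m, `|l - u m| <= 2 * C / 2 ^+ m.
Proof.
move=> uC.
pose e m : R := 2 * C / 2 ^+ m.
have eS m : e m = e m.+1 + C / 2 ^+ m.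
  rewrite /e exprS invfM; have : (2 : R) != 0 by [].
  by move=> h; field; rewrite expf_neq0.
have C0 : 0 <= C by have := uC 0%N; rewrite expr0 divr1; apply: le_trans.
have e0 m : 0 <= e m by rewrite !mulr_ge0 // invr_ge0 exprn_ge0.
have lo m k : u m - e m <= u (m + k)%N - e (m + k)%N.
  elim: k => [|k IH]; first by rewrite addn0.
  rewrite addnS; apply: le_trans IH _; rewrite eS.
  have := uC (m + k)%N; rewrite ler_norml => /andP[]; lra.
have hi m k : u (m + k)%N + e (m + k)%N <= u m + e m.
  elim: k => [|k IH]; first by rewrite addn0.
  rewrite addnS; apply: le_trans _ IH; rewrite [e (m + k)%N]eS.
  have := uC (m + k)%N; rewrite ler_norml => /andP[]; lra.
have lohi m k : u m - e m <= u k + e k.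
  have := lo m k; have := hi k m; rewrite addnC; have := e0 (m + k)%N; lra.
pose S := [set u m - e m | m in [set: nat]].
have Sub m : ubound S (u m + e m) by move=> _ [k _ <-].
have S0 : S !=set0 by exists (u 0%N - e 0%N), 0%N.
exists (sup S) => m; rewrite -/(e m).
rewrite ler_distl; apply/andP; split.
  by apply: ub_le_sup; [exists (u 0%N + e 0%N) | exists m].
exact: ge_sup.
Qed.

Lemma geometric_eq0 (x C : R) : (forall m, `|x| <= C / 2 ^+ m) -> x = 0.
Proof.
move=> xC; apply/eqP; rewrite -normr_eq0.
have C0 : 0 <= C by have := xC 0%N; rewrite expr0 divr1; apply: le_trans.
apply/negPn/negP => x0; have xp : 0 < `|x| by rewrite lt_neqAle eq_sym x0 normr_ge0.
pose m := Num.Def.archi_bound (C / `|x|).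
have := Num.Theory.upper_nthrootP (leqnn m); rewrite ltr_pdivrMr // mulrC.
by rewrite -ltr_pdivrMr ?exprn_gt0 // ltNge xC.
Qed.

Definition clamp (a b s : R) : R := Num.max a (Num.min s b).

Lemma clamp_itv a b s : a <= b -> a <= clamp a b s <= b.
Proof. by move=> ab; rewrite le_max lexx /= ge_max ab ge_min lexx orbT. Qed.

Lemma clamp_id a b s : a <= s <= b -> clamp a b s = s.
Proof. by case/andP => as_ sb; rewrite /clamp min_l // max_r. Qed.

Lemma clamp_continuous a b : continuous (clamp a b).
Proof.
move=> s; apply: (@continuous_max _ _ (cst a) (fun s => Num.min s b)).
  exact: cvg_cst.
apply: (@continuous_min _ _ id (cst b)); [exact: cvg_id|exact: cvg_cst].
Qed.

(** A primitive of [g] over the open interval from [-1] to [2], made constant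
    outside, so that it is defined, continuous and bounded on the whole line. *)
Definition primitive (g G : R -> R) : Prop :=
  [/\ continuous G, G 0 = 0, forall s, G (clamp (-1) 2 s) = G s &
      forall s : R, -1 < s < 2 -> is_derive s 1 G (g s)].

Lemma primitive_exists g : continuous g -> exists G, primitive g G.
Proof.
move=> cg.
pose F (x : R) := (\int[lebesgue_measure]_(t in `[-2, x]) g t)%R.
have dF (s : R) : -1 <= s <= 2 -> is_derive s 1 F (g s).
  move=> /andP[s1 s2].
  have s3 : s < 3 by lra.
  have s2' : -2 < s by lra.
  have ig : lebesgue_measure.-integrable `[-2, 3 : R] (EFin \o g).
    apply: continuous_compact_integrable; first exact: segment_compact.
    exact: continuous_subspaceT.
  have [dF E] := continuous_FTC1_closed s3 ig s2' (cg s).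
  by apply: DeriveDef => //; rewrite -derive1E.
have cF (s : R) : -1 <= s <= 2 -> {for s, continuous F}.
  move=> /dF [+ _]; move=> /derivable1_diffP; exact: differentiable_continuous.
pose c := clamp (-1) 2.
have c12 s : -1 <= c s <= 2 by apply: clamp_itv; lra.
exists (fun s => F (c s) - F 0); split.
- move=> s; apply: cvgB; last exact: cvg_cst.
  by apply: continuous_comp; [exact: clamp_continuous|exact: cF].
- by rewrite /c clamp_id ?subrr //; lra.
- by move=> s; rewrite /c (clamp_id (c12 s)).
move=> s s12.
have e : \near s, F s - F 0 = F (c s) - F 0.
  have : \forall t \near s, t \in `]-1, 2[ by exact: near_in_itvoo.
  apply: filterS => t; rewrite in_itv /= => /andP[t1 t2].
  by rewrite /c clamp_id // !ltW.
apply: near_eq_is_derive e _; rewrite -[g s]subr0.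
apply: is_deriveB; apply: dF; case/andP: s12 => ? ?; rewrite !ltW //.
Qed.

Lemma primitive_bound g1 g2 G1 G2 C : primitive g1 G1 -> primitive g2 G2 ->
  (forall s, `|g1 s - g2 s| <= C) -> forall s, `|G1 s - G2 s| <= 2 * C.
Proof.
move=> [c1 z1 k1 d1] [c2 z2 k2 d2] gC s; rewrite -k1 -k2.
have C0 : 0 <= C by apply: le_trans (gC 0).
have : (-1 : R) <= clamp (-1) 2 s <= 2 by apply: clamp_itv; lra.
set t := clamp _ _ _ => /andP[t1 t2].
have D (u : R) : -1 < u < 2 -> is_derive u 1 (G1 - G2) (g1 u - g2 u).
  by move=> u12; apply: is_deriveB; [exact: d1|exact: d2].
have cD : continuous (G1 - G2) by move=> u; apply: cvgB; [exact: c1|exact: c2].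
have D0 : (G1 - G2) 0 = 0 by rewrite -[LHS]/(G1 0 - G2 0) z1 z2 subrr.
have [t0|t0|->] := ltgtP t 0; last by rewrite z1 z2 subrr normr0 mulr_ge0.
- have [|c _] := @MVT R _ (fun u => g1 u - g2 u) _ _ t0 _ (continuous_subspaceT cD).
    by move=> u; rewrite in_itv /= => /andP[? ?]; apply: D; lra.
  rewrite D0 sub0r sub0r => E.
  have -> : G1 t - G2 t = (g1 c - g2 c) * t.
    by apply: oppr_inj; rewrite -mulrN -E.
  rewrite normrM mulrC; apply: ler_pM => //; rewrite ltr0_norm //; lra.
- have [|c _] := @MVT R _ (fun u => g1 u - g2 u) _ _ t0 _ (continuous_subspaceT cD).
    by move=> u; rewrite in_itv /= => /andP[? ?]; apply: D; lra.
  rewrite D0 !subr0 => E.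
  have -> : G1 t - G2 t = (g1 c - g2 c) * t by rewrite -E.
  rewrite normrM mulrC; apply: ler_pM => //; rewrite gtr0_norm //.
Qed.

End LinearODE.

Section Picard.
Context {R : realType}.

(** The radius of a ball on which a system with coefficients bounded by [C] is a
    contraction along the rays from the centre. *)
Lemma small_radius N (r C : R) : 0 < r -> 0 <= C ->
  exists rho, [/\ 0 < rho, rho <= r, rho <= 1 & 4 * (N%:R * (C * rho)) <= 1].
Proof.
move=> r0 C0; pose D : R := 4 * (N%:R * C) + 1.
have NC : 0 <= N%:R * C by rewrite mulr_ge0.
have D1 : 1 <= D by rewrite /D; lra.
have D0 : 0 < D by exact: lt_le_trans D1.
exists (Num.min r D^-1); split.
- by rewrite lt_min r0 invr_gt0.
- by rewrite ge_min lexx.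
- by rewrite ge_min invf_le1 // D1 orbT.
have : Num.min r D^-1 <= D^-1 by rewrite ge_min lexx orbT.
move=> h; apply: (@le_trans _ _ (4 * (N%:R * C) * D^-1)).
  have -> : 4 * (N%:R * (C * Num.min r D^-1)) = 4 * (N%:R * C) * Num.min r D^-1.
    by ring.
  by rewrite ler_wpM2l // mulr_ge0.
by rewrite ler_pdivrMr // mul1r /D; lra.
Qed.

(** A Gronwall inequality for systems whose growth rate is at most one half on
    the unit interval: at a point where the largest component is attained, the
    mean value theorem bounds the maximum by half of itself plus [E]. *)
Lemma half_growth_bound (T : finType) (d d' : T -> R -> R) (E : R) :
  (forall i (s : R), 0 <= s <= 1 -> is_derive s 1 (d i) (d' i s)) ->
  (forall i, d i 0 = 0) ->
  (forall M, (forall j s, 0 <= s <= 1 -> `|d j s| <= M) ->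
     forall i s, 0 <= s <= 1 -> `|d' i s| <= M / 2 + E) ->
  forall i s, 0 <= s <= 1 -> `|d i s| <= 2 * E.
Proof.
move=> dd d0 dM i0 s0 s01.
have cd i : {within `[0, 1], continuous (d i)}.
  apply: derivable_within_continuous => s; rewrite in_itv /= => h.
  exact: (@ex_derive _ _ _ _ _ _ _ (dd i s h)).
have cn i : {within `[0, 1], continuous (fun s => `|d i s|)}.
  by move=> s; apply: cvg_norm; exact: cd.
have mx i : exists c, 0 <= c <= 1 /\ forall t, 0 <= t <= 1 -> `|d i t| <= `|d i c|.
  have [c] := EVT_max (@ler01 R) (cn i).
  rewrite in_itv /= => c01 cm; exists c; split=> [//|t t01].
  by apply: cm; rewrite in_itv.
have [c cP] := choice mx.
pose i1 := [arg max_(i > i0) `|d i (c i)|]%O.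
pose M := `|d i1 (c i1)|.
have MP j s : 0 <= s <= 1 -> `|d j s| <= M.
  move=> h; apply: le_trans ((cP j).2 s h) _; rewrite /M /i1.
  by case: arg_maxP => // i _; apply.
apply: le_trans (MP i0 s0 s01) _.
have /andP[c0 c1] := (cP i1).1.
have [e] : exists2 e, e \in `[0, c i1]%R &
    d i1 (c i1) - d i1 0 = d' i1 e * (c i1 - 0).
  apply: MVT_segment => // [s|].
    by rewrite in_itv /= => /andP[? ?]; apply: dd; lra.
  apply: derivable_within_continuous => s; rewrite in_itv /= => h.
  by apply: (@ex_derive _ _ _ _ _ _ _ (dd i1 s _)); lra.
rewrite in_itv /= d0 !subr0 => /andP[e0 ec] E1.
have e01 : 0 <= e <= 1 by lra.
have := dM M MP i1 e e01; rewrite {1}/M in MP *.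
have : M <= `|d' i1 e|.
  by rewrite /M E1 normrM ler_piMr // ger0_norm.
lra.
Qed.

(** Picard iteration, on a system small enough for it to be a contraction with
    ratio one half in the uniform norm. *)
Lemma linear_ode N (B : R -> 'M[R]_N) K (f0 : 'cV[R]_N) :
  (forall i j, continuous (fun s => B s i j)) ->
  (forall s, `|B s| <= K) -> 4 * (N%:R * K) <= 1 ->
  exists phi : R -> 'cV[R]_N, phi 0 = f0 /\
    forall (s : R) i, -1 < s < 2 ->
      is_derive s 1 (fun s => phi s i 0) ((B s *m phi s) i 0).
Proof.
move=> cB BK NK.
have K0 : 0 <= K by apply: le_trans (BK 0).
have /choice[P PP] : forall g : R -> R, exists G : R -> R,
    continuous g -> primitive g G.
  move=> g.
  have [cg|ncg] := pselect (continuous g); last by exists g.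
  by have [G GP] := primitive_exists cg; exists G.
pose rhs (p : R -> 'cV[R]_N) i s := (B s *m p s) i 0.
pose S p : R -> 'cV[R]_N := fun s => f0 + \col_i P (rhs p i) s.
pose cont (p : R -> 'cV[R]_N) := forall i, continuous (fun s => p s i 0).
have crhs p i : cont p -> continuous (rhs p i).
  move=> cp s.
  have -> : rhs p i = (fun s => \sum_j B s i j * p s j 0).
    by apply/funext => t; rewrite /rhs mxE.
  apply: continuous_at_sum => j.
  by apply: (@cvgM _ _ (nbhs s)); [exact: cB|exact: cp].
have Srhs p i : cont p -> primitive (rhs p i) (P (rhs p i)).
  by move=> cp; exact/PP/crhs.
have cS p : cont p -> cont (S p).
  move=> cp i s.
  have -> : (fun s => S p s i 0) = (fun s => f0 i 0 + P (rhs p i) s).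
    by apply/funext => t; rewrite /S !mxE.
  apply: (@cvgD _ _ _ (nbhs s)); first exact: cvg_cst.
  by have [+ _ _ _] := Srhs p i cp; exact.
have Slip p q C : cont p -> cont q -> (forall s, `|p s - q s| <= C) ->
    forall s, `|S p s - S q s| <= C / 2.
  move=> cp cq pq s.
  have C0 : 0 <= C by apply: le_trans (pq 0).
  apply: norm_le_entry => [|i j]; first by rewrite divr_ge0.
  rewrite ord1 !mxE opprD addrACA subrr add0r.
  have h : forall s, `|rhs p i s - rhs q i s| <= C / 4.
    move=> t; have -> : rhs p i t - rhs q i t = (B t *m (p t - q t)) i 0.
      by rewrite /rhs mulmxBr [RHS]mxE; congr (_ + _); rewrite [RHS]mxE.
    apply: le_trans (entry_le_norm _ _ _) _.
    apply: le_trans (norm_mulmx _ _) _.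
    apply: (@le_trans _ _ (N%:R * K * C)).
      apply: ler_pM (pq t) => //.
      exact: ler_wpM2l (BK t).
    have : (1 - 4 * (N%:R * K)) * C >= 0 by rewrite mulr_ge0 // subr_ge0.
    lra.
  have := primitive_bound (Srhs p i cp) (Srhs q i cq) h s.
  by have -> : 2 * (C / 4) = C / 2 by lra.
pose phi m := iter m S (fun=> 0).
have cphi m : cont (phi m).
  elim: m => [i s|m IH]; last exact: cS.
  have -> : (fun s => phi 0%N s i 0) = (fun=> 0).
    by apply/funext => t; rewrite /phi /= mxE.
  exact: cvg_cst.
have [C phiC] : exists C, forall s, `|phi 1%N s - phi 0%N s| <= C.
  exists `|f0| => s; rewrite /phi /= subr0 /S.
  suff -> : \col_i P (rhs (fun=> 0) i) s = 0 by rewrite addr0.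
  apply/matrixP => i j; rewrite !mxE.
  have p0 : primitive (fun=> 0 : R) (fun=> 0 : R).
    split=> // [t|t _]; first exact: cvg_cst.
    exact: is_derive_cst.
  have := primitive_bound (Srhs (fun=> 0) i (cphi 0%N)) p0 (C := 0).
  rewrite mulr0 => /(_ _ s); rewrite subr0 normr_le0 => h; apply/eqP/h => t.
  by rewrite /rhs mulmx0 mxE subrr normr0.
have C0 : 0 <= C by apply: le_trans (phiC 0).
have phiS m s : `|phi m.+1 s - phi m s| <= C / 2 ^+ m.
  elim: m s => [s|m IH s]; first by rewrite expr0 divr1.
  have -> : C / 2 ^+ m.+1 = C / 2 ^+ m / 2 by rewrite exprS invfM mulrCA mulrC.
  exact: (Slip _ _ _ (cphi m.+1) (cphi m) IH s).
have /choice[lim limP] : forall s, exists l : 'cV[R]_N, forall m,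
    `|l - phi m s| <= 2 * C / 2 ^+ m.
  move=> s.
  have /choice[l lP] : forall i, exists l, forall m,
      `|l - phi m s i 0| <= 2 * C / 2 ^+ m.
    move=> i; apply: geometric_limit => m; apply: le_trans _ (phiS m s).
    by have := entry_le_norm (phi m.+1 s - phi m s) i 0; rewrite !mxE.
  exists (\col_i l i) => m; apply: norm_le_entry => [|i j].
    by rewrite divr_ge0 ?mulr_ge0 // exprn_ge0.
  by rewrite ord1 !mxE.
have clim : cont lim.
  move=> i s; apply/cvgrPdist_lt => e e0.
  have [m me] : exists m, 2 * C / 2 ^+ m < e / 3.
    exists (Num.Def.archi_bound (6 * C / e)).
    have := Num.Theory.upper_nthrootP (leqnn (Num.Def.archi_bound (6 * C / e))).
    rewrite ltr_pdivrMr // => h.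
    rewrite ltr_pdivrMr ?exprn_gt0 //; lra.
  have := cphi m i s; move=> /cvgrPdist_lt/(_ (e / 3)).
  rewrite divr_gt0 // => /(_ isT); apply: filterS => t h.
  have lm u : `|lim u i 0 - phi m u i 0| < e / 3.
    apply: le_lt_trans me; apply: le_trans (limP u m).
    by have := entry_le_norm (lim u - phi m u) i 0; rewrite !mxE.
  have := ler_distD (phi m s i 0) (lim s i 0) (lim t i 0).
  have := ler_distD (phi m t i 0) (phi m s i 0) (lim t i 0).
  have := lm s; have := lm t; rewrite [`|lim t i 0 - _|]distrC; lra.
have fix_lim s : lim s = S lim s.
  apply/eqP; rewrite -subr_eq0; apply/eqP.
  suff h m : `|lim s - S lim s| <= 2 * C / 2 ^+ m.
    apply/matrixP => i j; rewrite [RHS]mxE; apply: (@geometric_eq0 _ _ (2 * C)) => m.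
    exact: le_trans (entry_le_norm _ _ _) (h m).
  have h1 := limP s m.+1.
  have h0 t : `|phi m t - lim t| <= 2 * C / 2 ^+ m by rewrite distrC.
  have h2 := Slip _ _ _ (cphi m) clim h0 s.
  rewrite -(subrKA (phi m.+1 s)); apply: le_trans (ler_normD _ _) _.
  apply: (@le_trans _ _ (2 * C / 2 ^+ m.+1 + 2 * C / 2 ^+ m / 2)).
    exact: lerD.
  by rewrite exprS invfM; lra.
exists lim; split.
  rewrite fix_lim /S; apply/matrixP => i j; rewrite ord1 !mxE.
  by have [_ -> _ _] := Srhs lim i clim; rewrite addr0.
move=> s i s12.
have -> : (fun s => lim s i 0) = cst (f0 i 0) + P (rhs lim i).
  by apply/funext => t; rewrite fix_lim !mxE.
rewrite -[X in is_derive _ _ _ X]add0r; apply: is_deriveD.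
by have [_ _ _] := Srhs lim i clim; exact.
Qed.

End Picard.

(** * Linear total differential systems *)

Section TotalDifferentialSystem.
Context {R : realType} {n N : nat}.
Variables (A : 'I_n -> 'rV[R]_n -> 'M[R]_N).
Implicit Types (h z p : 'rV[R]_n) (U : set 'rV[R]_n).

Definition partial_mx b c p : 'M[R]_N :=
  \matrix_(i, j) pderiv b (fun q => A c q i j) p.

(** The value on the vector [z] of the matrix-valued one-form [A_c dx^c]. *)
Definition form_at z p : 'M[R]_N := \sum_c z 0 c *: A c p.

(** The derivative of [form_at z] in the direction [h]. *)
Definition dform_at h z p : 'M[R]_N :=
  \sum_b \sum_c (h 0 b * z 0 c) *: partial_mx b c p.

(** The equality of the mixed second derivatives of a solution of
    [d_b y = A_b y]. *)
Definition integrable_on U := forall p, U p -> forall b c,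
  partial_mx b c p + A c p *m A b p = partial_mx c b p + A b p *m A c p.

Definition solves_on U (y : 'rV[R]_n -> 'cV[R]_N) := forall p, U p -> forall i,
  differentiable (fun q => y q i 0) p /\
  forall b, pderiv b (fun q => y q i 0) p = (A b p *m y p) i 0.

Lemma form_atE z p i j : form_at z p i j = \sum_c z 0 c * A c p i j.
Proof. by rewrite summxE; apply: eq_bigr => c _; rewrite mxE. Qed.

Lemma dform_atE h z p i j : dform_at h z p i j =
  \sum_c z 0 c * \sum_b h 0 b * pderiv b (fun q => A c q i j) p.
Proof.
rewrite /dform_at exchange_big /= summxE; apply: eq_bigr => c _.
rewrite summxE mulr_sumr; apply: eq_bigr => b _; rewrite !mxE; ring.
Qed.

Lemma form_atD z h p : form_at (z + h) p = form_at z p + form_at h p.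
Proof.
by rewrite -big_split; apply: eq_bigr => c _; rewrite mxE scalerDl.
Qed.

Lemma dform_atZ s h z p : dform_at (s *: h) z p = s *: dform_at h z p.
Proof.
rewrite scaler_sumr; apply: eq_bigr => b _; rewrite scaler_sumr.
by apply: eq_bigr => c _; rewrite mxE scalerA mulrA.
Qed.

Lemma form_at_integrable U h z p : integrable_on U -> U p ->
  dform_at h z p + form_at z p *m form_at h p =
  dform_at z h p + form_at h p *m form_at z p.
Proof.
move=> /[swap] Up /(_ p Up) int.
have mulc u v : form_at u p *m form_at v p =
    \sum_b \sum_c (v 0 b * u 0 c) *: (A c p *m A b p).
  rewrite /form_at mulmx_sumr; apply: eq_bigr => b _.
  rewrite mulmx_suml; apply: eq_bigr => c _.
  by rewrite -scalemxAl -scalemxAr scalerA mulrC.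
have both u v : dform_at u v p + form_at v p *m form_at u p =
    \sum_b \sum_c (u 0 b * v 0 c) *: (partial_mx b c p + A c p *m A b p).
  rewrite mulc -big_split; apply: eq_bigr => b _.
  by rewrite -big_split; apply: eq_bigr => c _; rewrite scalerDr.
rewrite !both exchange_big; apply: eq_bigr => c _; apply: eq_bigr => b _.
by rewrite int mulrC.
Qed.

Section LocalBounds.
Variables (U : set 'rV[R]_n) (x0 : 'rV[R]_n).
Hypotheses (oU : open U) (Ux0 : U x0).
Hypothesis sA : forall b i j, smooth_on U (fun p => A b p i j).

(** All the constants needed for the comparison of neighbouring rays, merged
    into one. *)
Lemma form_at_bounds : exists r C, [/\ 0 < r, 0 <= C,
    forall p, `|p - x0| < r -> U p,
    forall p z, `|p - x0| < r -> `|form_at z p| <= C * `|z| &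
    forall p h z, `|p - x0| < r -> `|p + h - x0| < r ->
      `|form_at z (p + h) - form_at z p - dform_at h z p|
        <= C * `|h| ^+ 2 * `|z| /\
      `|dform_at h z p| <= C * `|h| * `|z|].
Proof.
have HA : \forall M \near +oo, forall b i j y, `|y - x0| < M^-1 -> `|A b y i j| <= M.
  apply: filter_forall => b; apply: filter_forall => i; apply: filter_forall => j.
  exact: near_bounded (sA b i j 0%N x0 Ux0).
have HD : \forall M \near +oo, forall a b i j y, `|y - x0| < M^-1 ->
    `|pderiv a (fun q => A b q i j) y| <= M.
  apply: filter_forall => a; apply: filter_forall => b.
  apply: filter_forall => i; apply: filter_forall => j.
  exact: near_bounded (smooth_pderiv a (sA b i j) 0%N x0 Ux0).
have HT : \forall M \near +oo, forall b i j y h,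
    `|y - x0| < M^-1 -> `|y + h - x0| < M^-1 ->
    `|A b (y + h) i j - A b y i j -
      \sum_k h 0 k * pderiv k (fun q => A b q i j) y| <= M * `|h| ^+ 2.
  apply: filter_forall => b; apply: filter_forall => i; apply: filter_forall => j.
  have := near_taylor oU Ux0 (sA b i j).
  by apply: filterS => M HM y h; exact: HM.
have [M [M0 MU MA [MD MT]]] : exists M, [/\ 0 < M,
    (forall y, `|y - x0| < M^-1 -> U y),
    (forall b i j y, `|y - x0| < M^-1 -> `|A b y i j| <= M) &
    (forall a b i j y, `|y - x0| < M^-1 ->
      `|pderiv a (fun q => A b q i j) y| <= M) /\
    (forall b i j y h, `|y - x0| < M^-1 -> `|y + h - x0| < M^-1 ->
    `|A b (y + h) i j - A b y i j -
      \sum_k h 0 k * pderiv k (fun q => A b q i j) y| <= M * `|h| ^+ 2)].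
  apply: (@filter_ex _ (+oo : set_system R)); near=> M; split; [| | |split]; near: M.
  - exact: (nbhs_pinfty_gt (num_real _)).
  - exact: near_ball_sub.
  - exact: HA.
  - exact: HD.
  - exact: HT.
exists M^-1, (n%:R * M + n%:R * (n%:R * M)).
have nM : 0 <= n%:R * M by rewrite mulr_ge0 // ltW.
have nnM : 0 <= n%:R * (n%:R * M) by rewrite mulr_ge0.
have C0 : 0 <= n%:R * M + n%:R * (n%:R * M) by exact: addr_ge0.
split=> // [|p z pM|p h z pM phM]; first by rewrite invr_gt0.
- apply: norm_le_entry => [|i j]; first by rewrite mulr_ge0.
  rewrite form_atE; apply: le_trans (sum_coord_le (M := M) _ _) _ => [c|].
    exact: MA.
  by rewrite ler_wpM2r // lerDl.
split; apply: norm_le_entry => [|i j]; rewrite ?mulr_ge0 ?exprn_ge0 //.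
- have -> : (form_at z (p + h) - form_at z p - dform_at h z p) i j =
      \sum_c z 0 c * (A c (p + h) i j - A c p i j -
         \sum_k h 0 k * pderiv k (fun q => A c q i j) p).
    rewrite !mxE form_atE form_atE dform_atE -!sumrB.
    by apply: eq_bigr => c _; rewrite !mulrBr.
  apply: le_trans (sum_coord_le (M := M * `|h| ^+ 2) _ _) _ => [c|].
    exact: MT.
  rewrite mulrA ler_wpM2r // ler_wpM2r ?exprn_ge0 // lerDl //.
- rewrite dform_atE.
  apply: le_trans (sum_coord_le (M := n%:R * M * `|h|) _ _) _ => [c|].
    by apply: sum_coord_le => b; exact: MD.
  by rewrite ler_wpM2r // [X in X <= _]mulrA ler_wpM2r // lerDr.
Unshelve. all: by end_near. Qed.

End LocalBounds.
End TotalDifferentialSystem.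

Section Frobenius.
Context {R : realType} {n N : nat}.
Variables (A : 'I_n -> 'rV[R]_n -> 'M[R]_N) (U : set 'rV[R]_n) (x0 : 'rV[R]_n).
Hypotheses (oU : open U) (Ux0 : U x0).
Hypothesis sA : forall b i j, smooth_on U (fun p => A b p i j).
Implicit Types (h z p : 'rV[R]_n).

Lemma smooth_form_at k i j : smooth_on U (fun p => form_at A k p i j).
Proof.
under eq_fun do rewrite form_atE.
by apply: smooth_sum => // c; apply: smoothM => //; exact: smooth_cst.
Qed.

Lemma is_derive_form_ray z k (s : R) i j : U (x0 + s *: z) ->
  is_derive s 1 (fun s => form_at A k (x0 + s *: z) i j)
    (dform_at A z k (x0 + s *: z) i j).
Proof.
move=> Us.
have := is_derive_line (smooth_diff (smooth_form_at k i j) Us).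
congr is_derive; rewrite dform_atE.
under [RHS]eq_bigr do rewrite mulr_sumr.
rewrite exchange_big; apply: eq_bigr => b _ /=.
have dA c : differentiable (fun q => A c q i j) (x0 + s *: z).
  exact: smooth_diff (sA c i j) Us.
under eq_fun do rewrite form_atE.
rewrite pderiv_sum => [|c]; last exact/differentiableM.
rewrite mulr_sumr; apply: eq_bigr => c _.
rewrite pderivM // pderiv_cst mul0r add0r; ring.
Qed.

(** Transport along the rays from [x0]. *)
Lemma ray_solution z (y0 : 'cV[R]_N) K :
  (forall s, 0 <= s <= 1 -> U (x0 + s *: z)) ->
  (forall s, 0 <= s <= 1 -> `|form_at A z (x0 + s *: z)| <= K) ->
  4 * (N%:R * K) <= 1 ->
  exists phi : R -> 'cV[R]_N, [/\ phi 0 = y0,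
    forall (s : R) i, 0 <= s <= 1 ->
      is_derive s 1 (fun s => phi s i 0)
        ((form_at A z (x0 + s *: z) *m phi s) i 0) &
    forall s, 0 <= s <= 1 -> `|phi s| <= 2 * `|y0|].
Proof.
move=> Uz zK NK.
have c01 (s : R) : 0 <= clamp 0 1 s <= 1 by exact: clamp_itv.
(* The ray is frozen outside the unit interval, where it may leave [U]. *)
pose B s := form_at A z (x0 + clamp 0 1 s *: z).
have cB i j : continuous (fun s => B s i j).
  move=> s; apply: (@continuous_comp _ _ _ (fun s => x0 + clamp 0 1 s *: z)
    (fun p => form_at A z p i j)).
    apply: (@cvgD _ _ _ (nbhs s)); first exact: cvg_cst.
    by apply: (@cvgZr_tmp _ _ _ (nbhs s)); exact: clamp_continuous.
  exact: (smooth_form_at z i j 0%N _ (Uz _ (c01 s))).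
have [|phi [phi0 dphi]] := linear_ode y0 cB _ NK; first by move=> s; exact: zK.
have d01 (s : R) i : 0 <= s <= 1 -> is_derive s 1 (fun s => phi s i 0)
    ((form_at A z (x0 + s *: z) *m phi s) i 0).
  move=> s01; have := dphi s i; rewrite /B clamp_id //; apply.
  by case/andP: s01 => ? ?; lra.
have NK0 : 0 <= N%:R * K.
  by rewrite mulr_ge0 //; apply: le_trans (zK 0 _); rewrite ?lexx ?ler01.
exists phi; split=> // s s01.
have h i t : 0 <= t <= 1 -> `|phi t i 0 - y0 i 0| <= 2 * (`|y0| / 4).
  apply: (@half_growth_bound _ _ (fun i s => phi s i 0 - y0 i 0)
     (fun i s => (form_at A z (x0 + s *: z) *m phi s) i 0)) => {i t}.
  - move=> i t t01; rewrite -[X in is_derive _ _ _ X]subr0.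
    by apply: is_deriveB; exact: d01.
  - by move=> i; rewrite phi0 subrr.
  move=> M dM i t t01; apply: le_trans (entry_le_norm _ _ _) _.
  apply: le_trans (norm_mulmx _ _) _.
  have M0 : 0 <= M by apply: le_trans (dM i t t01).
  have pM : `|phi t| <= M + `|y0|.
    rewrite -[phi t](subrK y0); apply: le_trans (ler_normD _ _) _.
    rewrite lerD2r; apply: norm_le_entry => // k l.
    by rewrite ord1 !mxE; exact: dM.
  apply: (@le_trans _ _ (N%:R * K * (M + `|y0|))).
    apply: ler_pM => //.
    by apply: ler_wpM2l => //; exact: zK.
  have : 0 <= (1 - 4 * (N%:R * K)) * (M + `|y0|).
    by rewrite mulr_ge0 ?subr_ge0 // addr_ge0.
  lra.
have y00 : 0 <= `|y0| by [].
have : `|phi s - y0| <= `|y0| / 2.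
  apply: norm_le_entry => [|i j]; first by rewrite divr_ge0.
  by rewrite ord1 !mxE; have := h i s s01; lra.
have := ler_normD (phi s - y0) y0; rewrite subrK; lra.
Qed.

(** The value at a point [x] is obtained by transport along the ray from [x0] to
    [x]. Comparing the rays to [x] and to [x + h], the difference between the
    transported vector and its expected first-order increment satisfies a
    linear equation whose source is of second order in [h], because the
    first-order terms cancel by integrability. *)
Theorem frobenius : integrable_on A U ->
  exists r, [/\ 0 < r, forall p, `|p - x0| < r -> U p &
    forall y0 : 'cV[R]_N, exists y : 'rV[R]_n -> 'cV[R]_N,
      y x0 = y0 /\ solves_on A [set p | `|p - x0| < r] y].
Proof.
move=> int.
have [r [C [r0 C0 rU HC HT]]] := form_at_bounds oU Ux0 sA.
have [rho [rho0 rhor rho1 NC]] := small_radius N r0 C0.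
exists rho; split=> // [p pr|y0]; first by apply: rU; exact: lt_le_trans rhor.
have ray z s : `|z| < rho -> 0 <= s <= 1 -> `|x0 + s *: z - x0| < rho.
  move=> zr /andP[s0 s1]; rewrite addrAC subrr add0r normrZ ger0_norm //.
  by apply: le_lt_trans zr; rewrite ler_piMl.
have rayr z s : `|z| < rho -> 0 <= s <= 1 -> `|x0 + s *: z - x0| < r.
  by move=> zr s01; apply: lt_le_trans rhor; exact: ray.
have rayU z s : `|z| < rho -> 0 <= s <= 1 -> U (x0 + s *: z).
  by move=> zr s01; apply: rU; exact: rayr.
have raybd k z s : `|k| < rho -> `|z| < rho -> 0 <= s <= 1 ->
    `|form_at A k (x0 + s *: z)| <= C * rho.
  move=> kr zr s01; apply: le_trans (HC _ _ (rayr z s zr s01)) _.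
  by rewrite ler_wpM2l // ltW.
have /choice[phi phiP] : forall z, exists phi : R -> 'cV[R]_N, `|z| < rho ->
    [/\ phi 0 = y0,
    forall (s : R) i, 0 <= s <= 1 -> is_derive s 1 (fun s => phi s i 0)
        ((form_at A z (x0 + s *: z) *m phi s) i 0) &
    forall s, 0 <= s <= 1 -> `|phi s| <= 2 * `|y0|].
  move=> z; have [zr|] := boolP (`|z| < rho); last by exists (fun=> 0).
  have [phi phiP] := @ray_solution z y0 (C * rho) (fun s => rayU z s zr)
    (fun s => raybd z z s zr zr) NC.
  by exists phi.
pose y p := phi (p - x0) 1.
pose F := 2 * `|y0|.
have F0 : 0 <= F by rewrite mulr_ge0.
(* The second-order constant in the comparison of neighbouring rays. *)
pose E : R := N%:R * (3 * C) * F + N%:R * (3 * C) * (N%:R * C * F).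
have E0 : 0 <= E by rewrite addr_ge0 // !mulr_ge0.
have key z h i : `|z| < rho -> `|z + h| < rho -> `|h| <= 1 ->
    `|phi (z + h) 1 i 0 - phi z 1 i 0
      - (form_at A h (x0 + z) *m phi z 1) i 0| <= 2 * (E * `|h| ^+ 2).
  move=> zr zhr h1.
  have [p0 dp bp] := phiP z zr; have [q0 dq _] := phiP (z + h) zhr.
  pose X (s : R) : 'rV[R]_n := x0 + s *: z; pose Y (s : R) : 'rV[R]_n := x0 + s *: (z + h).
  pose L s i := \sum_j form_at A h (X s) i j * phi z s j 0.
  pose d (i : 'I_N) (s : R) : R := phi (z + h) s i 0 - phi z s i 0 - s * L s i.
  pose L' s : 'cV[R]_N := dform_at A z h (X s) *m phi z s
     + form_at A h (X s) *m (form_at A z (X s) *m phi z s).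
  pose d' (i : 'I_N) (s : R) : R := (form_at A (z + h) (Y s) *m phi (z + h) s
    - form_at A z (X s) *m phi z s
    - (form_at A h (X s) *m phi z s + s *: L' s)) i 0.
  have dL i' (s : R) : 0 <= s <= 1 -> is_derive s 1 (L^~ i') (L' s i' 0).
    move=> s01.
    have -> : L^~ i' = \sum_j (fun s => form_at A h (X s) i' j * phi z s j 0).
      by apply/funext => t; rewrite fct_sumE.
    have -> : L' s i' 0 = \sum_j (form_at A h (X s) i' j *:
         ((form_at A z (X s) *m phi z s) j 0) +
         phi z s j 0 *: dform_at A z h (X s) i' j).
      rewrite [RHS]big_split /= [RHS]addrC [LHS]mxE.
      congr (_ + _); rewrite [LHS]mxE; apply: eq_bigr => j _ //.
      by rewrite /GRing.scale /= mulrC.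
    apply: is_derive_sum => j; apply: is_deriveM; last exact: dp.
    exact: is_derive_form_ray (rayU z s zr s01).
  have := @half_growth_bound R 'I_N d d' (E * `|h| ^+ 2) _ _ _ i 1.
  rewrite ler01 lexx => H.
  have -> : phi (z + h) 1 i 0 - phi z 1 i 0
      - (form_at A h (x0 + z) *m phi z 1) i 0 = d i 1.
    by rewrite /d /L /X mul1r scale1r mxE.
  apply: H => // [i' s s01|i'|M dM i' s s01].
  - have -> : d i' = (fun s => phi (z + h) s i' 0) - (fun s => phi z s i' 0)
        - (id * (L^~ i')) by [].
    have mE (P Q S T : 'cV[R]_N) c : (P - Q - (S + c *: T)) i' 0 =
        P i' 0 - Q i' 0 - (S i' 0 + c * T i' 0) by rewrite !mxE.
    rewrite /d' mE; apply: is_deriveB.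
      by apply: is_deriveB; [exact: dq|exact: dp].
    have -> : (form_at A h (X s) *m phi z s) i' 0 + s * L' s i' 0 =
        s *: L' s i' 0 + L s i' *: (1 : R).
      rewrite addrC; congr (_ + _); rewrite [LHS]mxE; exact: esym (mulr1 _).
    exact: (is_deriveM (is_derive_id s 1) (dL i' s s01)).
  - by rewrite /d p0 q0 subrr mul0r subrr.
  pose D : 'cV[R]_N := phi (z + h) s - phi z s - s *: (form_at A h (X s) *m phi z s).
  have DM : `|D| <= M.
    apply: norm_le_entry => [|k l]; first exact: le_trans (dM i' s s01).
    rewrite ord1; apply: le_trans _ (dM k s s01).
    by rewrite /D /d /L !mxE.
  have YX : Y s = X s + s *: h by rewrite /Y /X scalerDr addrA.
  set a1 := form_at A (z + h) (Y s); set az := form_at A z (X s).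
  set ah := form_at A h (X s).
  pose rest := a1 - az - ah - s *: dform_at A h z (X s).
  have -> : d' i' s = (a1 *m D + rest *m phi z s + s *: ((a1 - az) *m (ah *m phi z s))) i' 0.
    rewrite /d' -/a1 -/az -/ah.
    congr (fun_of_matrix _ _ _).
    have := form_at_integrable h z int (rayU z s zr s01).
    rewrite -/(X s) -/az -/ah => I1.
    have {}I1 : dform_at A z h (X s) = dform_at A h z (X s) + az *m ah - ah *m az.
      by rewrite I1 addrK.
    rewrite /L' -/az -/ah I1 /D /rest.
    rewrite !mulmxBr !mulmxBl mulmxDl -!scalemxAr -!scalemxAl -!mulmxA.
    move: (a1 *m phi (z + h) s) (a1 *m phi z s) (az *m phi z s) (ah *m phi z s)
      (a1 *m (ah *m phi z s)) (az *m (ah *m phi z s)) (ah *m (az *m phi z s))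
      (dform_at A h z (X s) *m phi z s) => u1 u2 u3 u4 u5 u6 u7 u8.
    apply/matrixP => k l; rewrite !mxE; ring.
  have s1 : `|s| <= 1 by case/andP: s01 => s0 s1; rewrite ger0_norm.
  have Xr : `|X s - x0| < r by exact: rayr.
  have Yr : `|X s + s *: h - x0| < r by rewrite -YX; exact: rayr.
  have h0 : 0 <= `|h| by [].
  have sh : `|s *: h| <= `|h| by rewrite normrZ ler_piMl.
  have shsq : `|s *: h| ^+ 2 <= `|h| ^+ 2 by rewrite ler_pXn2r ?nnegrE.
  have T1 k : `|form_at A k (Y s) - form_at A k (X s) - s *: dform_at A h k (X s)|
      <= C * `|h| ^+ 2 * `|k|.
    rewrite YX -dform_atZ; have [b1 _] := HT _ _ k Xr Yr.
    by apply: le_trans b1 _; rewrite ler_wpM2r // ler_wpM2l.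
  have T2 k : `|form_at A k (Y s) - form_at A k (X s)| <= 2 * C * `|h| * `|k|.
    have [_ b2] := HT _ _ k Xr Yr; rewrite dform_atZ in b2.
    rewrite -[X in `|X|](subrK (s *: dform_at A h k (X s))).
    apply: le_trans (ler_normD _ _) _; apply: le_trans (lerD (T1 k) b2) _.
    have hh : `|h| ^+ 2 <= `|h| by rewrite expr2 ler_piMr.
    have : C * `|h| ^+ 2 * `|k| <= C * `|h| * `|k|.
      by rewrite ler_wpM2r // ler_wpM2l.
    have : C * `|s *: h| * `|k| <= C * `|h| * `|k|.
      by rewrite ler_wpM2r // ler_wpM2l.
    lra.
  have zle : `|z| <= 1 by rewrite (le_trans (ltW zr)).
  have hC : 0 <= C * `|h| by rewrite mulr_ge0.
  have restE : `|rest| <= 3 * C * `|h| ^+ 2.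
    have -> : rest = (form_at A z (Y s) - az - s *: dform_at A h z (X s))
        + (form_at A h (Y s) - ah).
      rewrite /rest /a1 form_atD.
      by apply/matrixP => k l; rewrite !mxE; ring.
    apply: le_trans (ler_normD _ _) _; apply: le_trans (lerD (T1 z) (T2 h)) _.
    have : C * `|h| ^+ 2 * `|z| <= C * `|h| ^+ 2.
      by rewrite ler_piMr // mulr_ge0 // exprn_ge0.
    have -> : 2 * C * `|h| * `|h| = 2 * C * `|h| ^+ 2 by rewrite expr2 mulrA.
    lra.
  have diffE : `|a1 - az| <= 3 * C * `|h|.
    have -> : a1 - az = (form_at A z (Y s) - az) + form_at A h (Y s).
      by rewrite /a1 form_atD addrAC.
    apply: le_trans (ler_normD _ _) _.
    have b3 : `|form_at A h (Y s)| <= C * `|h| by apply: HC; rewrite YX.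
    apply: le_trans (lerD (T2 z) b3) _.
    have : 2 * (C * `|h|) * `|z| <= 2 * (C * `|h|) by rewrite ler_piMr // mulr_ge0.
    rewrite !mulrA; lra.
  have ahE : `|ah *m phi z s| <= N%:R * C * F * `|h|.
    apply: le_trans (norm_mulmx _ _) _.
    have -> : N%:R * C * F * `|h| = N%:R * (C * `|h|) * F by ring.
    by apply: ler_pM => //; [exact: ler_wpM2l (HC _ _ Xr)|exact: bp].
  have N0 : 0 <= N%:R :> R by [].
  have t1 : `|a1 *m D| <= M / 2.
    apply: le_trans (norm_mulmx _ _) _.
    have M0 : 0 <= M by apply: le_trans DM.
    apply: (@le_trans _ _ (N%:R * (C * rho) * M)).
      apply: ler_pM => //.
      by apply: ler_wpM2l => //; exact: raybd.
    have : 0 <= (1 - 4 * (N%:R * (C * rho))) * M by rewrite mulr_ge0 ?subr_ge0.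
    lra.
  have t2 : `|rest *m phi z s| <= N%:R * (3 * C) * F * `|h| ^+ 2.
    apply: le_trans (norm_mulmx _ _) _.
    have -> : N%:R * (3 * C) * F * `|h| ^+ 2 = N%:R * (3 * C * `|h| ^+ 2) * F by ring.
    by apply: ler_pM => //; [exact: ler_wpM2l restE|exact: bp].
  have t3 : `|s *: ((a1 - az) *m (ah *m phi z s))|
      <= N%:R * (3 * C) * (N%:R * C * F) * `|h| ^+ 2.
    rewrite normrZ; apply: le_trans (ler_piMl _ s1) _ => //.
    apply: le_trans (norm_mulmx _ _) _.
    have -> : N%:R * (3 * C) * (N%:R * C * F) * `|h| ^+ 2 =
      N%:R * (3 * C * `|h|) * (N%:R * C * F * `|h|) by ring.
    by apply: ler_pM => //; exact: ler_wpM2l diffE.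
  apply: le_trans (entry_le_norm _ _ _) _.
  apply: le_trans (ler_normD _ _) _.
  have := ler_normD (a1 *m D) (rest *m phi z s).
  rewrite /E; lra.
exists y; split.
  have r00 : `|0 : 'rV[R]_n| < rho by rewrite normr0.
  have [p0 dp _] := phiP 0 r00.
  apply/matrixP => i j; rewrite ord1 /y subrr; apply/eqP.
  rewrite -subr_eq0 -normr_le0 -(mulr0 2).
  apply: (@half_growth_bound _ _ (fun i s => phi 0 s i 0 - y0 i 0) (fun _ _ => 0)).
  - move=> k s s01; rewrite -[X in is_derive _ _ _ X]subr0; apply: is_deriveB.
    have := dp s k s01.
    suff -> : form_at A 0 (x0 + s *: 0) = 0 by rewrite mul0mx mxE.
    by rewrite /form_at big1 // => c _; rewrite mxE scale0r.
  - by move=> k; rewrite p0 subrr.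
  - move=> M dM k s s01; rewrite normr0 addr0 divr_ge0 //.
    exact: le_trans (dM k s s01).
  - by rewrite ler01 lexx.
move=> p /= pr i.
suff [dy ey] : differentiable (fun q => y q i 0) p /\
    forall b, pderiv b (fun q => y q i 0) p = (A b p *m y p) i 0 by [].
apply: differentiable_near0 => e e0.
have small (c : R) : 0 < c -> \forall h \near (0 : 'rV[R]_n), `|h| < c.
  move=> c0; have : \forall h \near (0 : 'rV[R]_n), ball 0 c h by exact: nbhsx_ballx.
  by apply: filterS => h; rewrite -ball_normE /= sub0r normrN.
have c1 : 0 < rho - `|p - x0| by rewrite subr_gt0.
have c2 : 0 < e / (2 * E + 1) by rewrite divr_gt0 // ltr_wpDl // mulr_ge0.
apply: filterS3 (small _ ltr01) (small _ c1) (small _ c2) => h /ltW h1 hc1 hc2.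
have hr : `|p - x0 + h| < rho.
  by apply: le_lt_trans (ler_normD _ _) _; rewrite addrC -ltrBrDr.
have he : 2 * E * `|h| <= e.
  move: hc2; rewrite ltr_pdivlMr ?ltr_wpDl ?mulr_ge0 // => hc2.
  have : 0 <= `|h| by []; lra.
have := key _ h i pr hr h1.
rewrite /y [h + p]addrC [p + h - x0]addrAC [x0 + _]addrC subrK.
have -> : \sum_k h 0 k * (A k p *m phi (p - x0) 1) i 0 =
    (form_at A h p *m phi (p - x0) 1) i 0.
  rewrite /form_at mulmx_suml summxE; apply: eq_bigr => b _.
  by rewrite -scalemxAl [RHS]mxE.
move=> H; apply: le_trans H _.
by rewrite expr2 !mulrA ler_wpM2r.
Qed.

End Frobenius.

Section Vanishing.
Context {R : realType} {n : nat}.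

(** Uniqueness for homogeneous linear systems: along the rays from [x0] the
    growth rate is small, and the initial value is zero. *)
Lemma vanish_near (T : finType) (w : T -> 'rV[R]_n -> R) x0 (r K : R) :
  0 < r -> 0 <= K ->
  (forall p, `|p - x0| < r -> forall i, differentiable (w i) p) ->
  (forall p M, `|p - x0| < r -> (forall j, `|w j p| <= M) ->
     forall b i, `|pderiv b (w i) p| <= K * M) ->
  (forall i, w i x0 = 0) ->
  exists rho, [/\ 0 < rho, rho <= r &
    forall p, `|p - x0| < rho -> forall i, w i p = 0].
Proof.
move=> r0 K0 dw bw w0.
have [rho [rho0 rhor _ NK]] := small_radius n r0 K0.
exists rho; split=> // p pr i.
pose z := p - x0.
have pE : p = x0 + 1 *: z by rewrite scale1r /z addrC subrK.
have ray (s : R) : 0 <= s <= 1 -> `|x0 + s *: z - x0| < r.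
  move=> /andP[s0 s1]; apply: lt_le_trans rhor.
  rewrite addrAC subrr add0r normrZ ger0_norm //.
  by apply: le_lt_trans pr; rewrite ler_piMl.
apply/eqP; rewrite -normr_le0 -(mulr0 2) pE.
apply: (@half_growth_bound _ _ (fun i s => w i (x0 + s *: z))
  (fun i s => \sum_k z 0 k * pderiv k (w i) (x0 + s *: z))).
- by move=> j s s01; apply: is_derive_line; exact/dw/ray.
- by move=> j; rewrite scale0r addr0.
- move=> M dM j s s01; rewrite addr0.
  have M0 : 0 <= M by apply: le_trans (dM j s s01).
  apply: le_trans (sum_coord_le (M := K * M) _ _) _ => [k|].
    by apply: bw (ray s s01) _ _ _ => l; exact: dM.
  have h1 : n%:R * (K * M) * `|z| <= n%:R * (K * M) * rho.
    by rewrite ler_wpM2l ?mulr_ge0 // ltW.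
  have : 0 <= (1 - 4 * (n%:R * (K * rho))) * M by rewrite mulr_ge0 // subr_ge0.
  lra.
- by rewrite ler01 lexx.
Qed.

End Vanishing.

(** * Positive definite matrices *)

Section PositiveDefinite.
Context {R : realType}.

Definition qform n (A : 'M[R]_n) (v : 'rV[R]_n) : R :=
  \sum_(a < n) \sum_(b < n) A a b * v 0 a * v 0 b.

Lemma qformE n (A : 'M[R]_n) v : qform A v = (v *m A *m v^T) 0 0.
Proof.
rewrite mxE /qform exchange_big; apply: eq_bigr => b _ /=.
rewrite [X in _ = X * _]mxE [X in _ = _ * X]mxE mulr_suml.
by apply: eq_bigr => a _; ring.
Qed.

Definition posdef n (A : 'M[R]_n) := forall v, v != 0 -> 0 < qform A v.

Lemma posdef_unitmx n (A : 'M[R]_n) : posdef A -> A \in unitmx.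
Proof.
move=> pA; rewrite -row_free_unit -kermx_eq0; apply/negPn/negP => /rowV0Pn[v].
move=> /sub_kermxP vA /pA.
by rewrite qformE vA mul0mx mxE ltxx.
Qed.

Lemma qform_gram n m (J : 'M[R]_(m, n)) v :
  qform (J^T *m J) v = \sum_t ((v *m J^T) 0 t) ^+ 2.
Proof.
rewrite qformE mulmxA -mulmxA -[J *m v^T]trmxK trmx_mul trmxK mxE.
by apply: eq_bigr => t _; rewrite [X in _ * X]mxE expr2.
Qed.

Lemma posdef_gram n (J : 'M[R]_n) : J \in unitmx -> posdef (J^T *m J).
Proof.
move=> uJ v v0; rewrite qform_gram lt_neqAle eq_sym.
rewrite sumr_ge0 ?andbT => [|t _]; last exact: sqr_ge0.
rewrite psumr_eq0 => [|t _]; last exact: sqr_ge0.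
apply/negP => /allP h; case/negP: v0; apply/eqP.
have : v *m J^T = 0.
  apply/matrixP => i t; rewrite ord1 [RHS]mxE; apply/eqP.
  by rewrite -sqrf_eq0; apply: h; rewrite mem_index_enum.
move=> /(congr1 (mulmx^~ (invmx J^T))); rewrite mulmxK ?unitmx_tr // => ->.
by rewrite mul0mx.
Qed.

(** Cholesky's factorization, by completing the square in the first
    variable. *)
Lemma gram_exists n (A : 'M[R]_n) : A^T = A -> posdef A ->
  exists E : 'M[R]_n, E^T *m E = A.
Proof.
elim: n A => [A _ _|n IH A].
  by exists 0; apply/matrixP => i; case: i.
rewrite -[n.+1]/(1 + n)%N in A *; move=> sA pA.
pose a := A 0 0; pose u : 'rV[R]_n := ursubmx A; pose D : 'M[R]_n := drsubmx A.
have aE : ulsubmx A = a%:M.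
  by apply/matrixP => i j; rewrite !ord1 !mxE /= /a; congr (A _ _); exact/val_inj.
have lE : dlsubmx A = u^T.
  by rewrite /u trmx_ursub sA.
have AE : A = block_mx a%:M u u^T D by rewrite -aE -lE submxK.
have sD : D^T = D by rewrite /D trmx_drsub sA.
have a0 : 0 < a.
  have e0 : row_mx 1%:M 0 != 0 :> 'rV[R]_(1 + n).
    apply/negP => /eqP /(congr1 lsubmx); rewrite row_mxKl linear0 => /matrixP/(_ 0 0).
    by rewrite !mxE => /eqP; rewrite oner_eq0.
  have := pA _ e0; rewrite qformE AE mul_row_block !mul1mx !mul0mx !addr0.
  by rewrite tr_row_mx mul_row_col trmx0 mulmx0 addr0 trmx1 mulmx1 mxE mulr1n.
have an0 : a != 0 by rewrite gt_eqF.
pose S : 'M[R]_n := D - a^-1 *: (u^T *m u).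
have sS : S^T = S by rewrite /S linearB /= linearZ /= trmx_mul trmxK sD.
have pS : posdef S.
  (* This [x] minimizes the form of [A] over the vectors extending [w]. *)
  move=> w w0; pose x : 'M[R]_1 := - a^-1 *: (w *m u^T).
  have xw0 : row_mx x w != 0.
    apply: contra w0 => /eqP /(congr1 rsubmx); rewrite row_mxKr linear0 => ->.
    by [].
  have := pA _ xw0; rewrite !qformE AE mul_row_block.
  have -> : x *m a%:M + w *m u^T = 0.
    by rewrite mul_mx_scalar scalerA mulrN mulfV // scaleN1r addNr.
  have -> : x *m u + w *m D = w *m S.
    by rewrite /S mulmxBr -scalemxAl -scalemxAr mulmxA addrC scaleNr.
  by rewrite tr_row_mx mul_row_col mul0mx add0r.
(* [S] is the Schur complement of the corner [a]. *)
have [E' EE'] := IH S sS pS.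
pose q := Num.sqrt a.
have qq : q * q = a by rewrite -expr2 sqr_sqrtr // ltW.
have qqa : q * q * a^-1 = 1 by rewrite qq mulfV.
exists (block_mx q%:M ((q * a^-1) *: u) 0 E').
rewrite tr_block_mx mulmx_block !trmx0 !mulmx0 !mul0mx !addr0 EE' [RHS]AE.
have trZ : ((q * a^-1) *: u)^T = (q * a^-1) *: u^T by exact: linearZ.
rewrite tr_scalar_mx trZ -!scalemxAl -!scalemxAr !mul_scalar_mx !mul_mx_scalar.
rewrite !scalerA -!mulrA.
congr block_mx.
- by rewrite scale_scalar_mx qq.
- rewrite -[RHS]scale1r -qqa; congr (_ *: _); ring.
- rewrite -[RHS]scale1r -qqa; congr (_ *: _); ring.
- rewrite -[RHS](subrK (a^-1 *: (u^T *m u))) addrC; congr (_ + _ *: _).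
  by rewrite -[RHS]mul1r -qqa; ring.
Qed.

End PositiveDefinite.

(** * Flat coordinates *)

Section Christoffel.
Context {R : realType} {n : nat}.
Variables (G : 'rV[R]_n -> 'M[R]_n) (U : set 'rV[R]_n).
Hypothesis oU : open U.
Hypothesis sG : forall a b, smooth_on U (fun x => G x a b).
Hypothesis symG : forall x, U x -> forall a b, G x a b = G x b a.
Hypothesis uG : forall x, U x -> G x \in unitmx.

Lemma smooth_christoffel a b c : smooth_on U (christoffel G a b c).
Proof.
apply: smoothM => //; first exact: smooth_cst.
apply: smooth_sum => // d; apply: smoothM => //; first exact: smooth_invmx.
apply: smoothB => //; last exact: smooth_pderiv.
by apply: smoothD => //; exact: smooth_pderiv.
Qed.

Lemma pderiv_sym x a b c : U x ->
  pderiv c (fun y => G y a b) x = pderiv c (fun y => G y b a) x.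
Proof.
by move=> Ux; apply: pderiv_near; apply: near_open oU Ux _ => y Uy; exact: symG.
Qed.

Lemma christoffel_sym x a b c : U x -> christoffel G a b c x = christoffel G a c b x.
Proof.
move=> Ux; rewrite /christoffel; congr (_ * _); apply: eq_bigr => d _.
by rewrite (pderiv_sym b c d Ux); ring.
Qed.

(** The Christoffel symbols of the first kind. *)
Lemma lower_christoffel x e b c : U x ->
  \sum_a G x e a * christoffel G a b c x =
  2^-1 * (pderiv b (fun y => G y e c) x + pderiv c (fun y => G y e b) x
          - pderiv e (fun y => G y b c) x).
Proof.
move=> Ux.
pose k d := pderiv b (fun y => G y d c) x + pderiv c (fun y => G y d b) x
          - pderiv d (fun y => G y b c) x.
rewrite -/(k e) /christoffel.
transitivity (2^-1 * \sum_d (G x *m invmx (G x)) e d * k d).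
  rewrite mulr_sumr.
  under eq_bigr do rewrite mulrCA mulr_sumr mulr_sumr.
  rewrite exchange_big; apply: eq_bigr => d _ /=.
  rewrite mxE mulr_suml mulr_sumr; apply: eq_bigr => a _; rewrite /k; ring.
congr (_ * _); rewrite mulmxV ?uG // (bigD1 e) //= big1 => [|d de].
  by rewrite mxE eqxx mul1r addr0.
by rewrite mxE eq_sym (negbTE de) mul0r.
Qed.

(** The Levi-Civita connection is metric. *)
Lemma pderiv_metric x a b c : U x ->
  pderiv c (fun y => G y a b) x =
  \sum_e (christoffel G e c a x * G x e b + christoffel G e c b x * G x a e).
Proof.
move=> Ux; rewrite big_split /=.
have -> : \sum_e christoffel G e c a x * G x e b =
    \sum_e G x b e * christoffel G e c a x.
  by apply: eq_bigr => e _; rewrite mulrC symG.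
have -> : \sum_e christoffel G e c b x * G x a e =
    \sum_e G x a e * christoffel G e c b x.
  by apply: eq_bigr => e _; rewrite mulrC.
rewrite !lower_christoffel // (pderiv_sym b a c Ux) (pderiv_sym b c a Ux).
rewrite (pderiv_sym a c b Ux); lra.
Qed.

End Christoffel.

Section Bootstrap.
Context {R : realType} {n N : nat}.

(** The derivatives of a solution are linear in the solution, so each degree of
    differentiability entails the next. *)
Lemma solves_smooth (A : 'I_n -> 'rV[R]_n -> 'M[R]_N) (U : set 'rV[R]_n) y :
  open U -> (forall b i j, smooth_on U (fun p => A b p i j)) ->
  solves_on A U y -> forall i, smooth_on U (fun p => y p i 0).
Proof.
move=> oU sA sy i r; elim: r i => [|r IH] i.
  by move=> x Ux; apply/differentiable_continuous; have [] := sy x Ux i.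
split=> [x Ux|b]; first by have [] := sy x Ux i.
have : Cr_on r U (fun p => \sum_j A b p i j * y p j 0).
  by apply: Cr_on_sum => // j; apply: Cr_onM => //; exact: sA.
apply: Cr_on_ext => // x Ux; have [_ ->] := sy x Ux i.
by rewrite mxE.
Qed.

End Bootstrap.

Section FlatCoordinates.
Context {R : realType} {n : nat}.
Variables (G : 'rV[R]_n -> 'M[R]_n) (U : set 'rV[R]_n) (x0 : 'rV[R]_n).
Hypotheses (oU : open U) (Ux0 : U x0).
Hypothesis sG : forall a b, smooth_on U (fun x => G x a b).
Hypothesis symG : forall x, U x -> forall a b, G x a b = G x b a.
Hypothesis pG : forall x, U x -> posdef (G x).
Hypothesis flatG : forall x, U x -> forall a b c d, curvature G a b c d x = 0.

Let uG x : U x -> G x \in unitmx.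
Proof. by move=> /pG; exact: posdef_unitmx. Qed.

Definition christoffel_mx b x : 'M[R]_n := \matrix_(c, a) christoffel G a b c x.

(** The system [d_b v = w_b], [d_b w_c = Gamma^a_bc w_a] for a function together
    with its differential, the latter being parallel. *)
Definition hessian_system b x : 'M[R]_(1 + n) :=
  block_mx 0 (delta_mx 0 b) 0 (christoffel_mx b x).

Lemma block_row_mul (u v : 'rV[R]_n) (A B C : 'M[R]_n) :
  block_mx (0 : 'M[R]_1) 0 0 C + block_mx 0 u 0 A *m block_mx 0 v 0 B =
  block_mx 0 (u *m B) 0 (C + A *m B).
Proof. by rewrite mulmx_block add_block_mx !mulmx0 !mul0mx !add0r. Qed.

Lemma smooth_hessian_system b i j : smooth_on U (fun x => hessian_system b x i j).
Proof.
rewrite /hessian_system /block_mx.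
case: (split_ordP i) => k ->; case: (split_ordP j) => l ->.
- under eq_fun do rewrite col_mxEu row_mxEl mxE; exact: smooth_cst.
- under eq_fun do rewrite col_mxEu row_mxEr mxE; exact: smooth_cst.
- under eq_fun do rewrite col_mxEd row_mxEl mxE; exact: smooth_cst.
- under eq_fun do rewrite col_mxEd row_mxEr mxE; exact: smooth_christoffel.
Qed.

(** The two nonzero blocks of the integrability condition are the symmetry of
    the Christoffel symbols in their lower indices and the vanishing of the
    curvature. *)
Lemma hessian_system_integrable : integrable_on hessian_system U.
Proof.
move=> x Ux b c.
have pE b' c' : partial_mx hessian_system b' c' x =
    block_mx 0 0 0 (\matrix_(d, a) pderiv b' (christoffel G a c' d) x).
  apply/matrixP => i j; rewrite mxE /hessian_system /block_mx.
  case: (split_ordP i) => k ->; case: (split_ordP j) => l ->.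
  - under eq_fun do rewrite col_mxEu row_mxEl mxE.
    by rewrite pderiv_cst col_mxEu row_mxEl mxE.
  - under eq_fun do rewrite col_mxEu row_mxEr mxE.
    by rewrite pderiv_cst col_mxEu row_mxEr mxE.
  - under eq_fun do rewrite col_mxEd row_mxEl mxE.
    by rewrite pderiv_cst col_mxEd row_mxEl mxE.
  - under eq_fun do rewrite col_mxEd row_mxEr mxE.
    by rewrite col_mxEd row_mxEr mxE.
have mE b' c' : partial_mx hessian_system b' c' x
      + hessian_system c' x *m hessian_system b' x =
    block_mx 0 (delta_mx 0 c' *m christoffel_mx b' x) 0
      ((\matrix_(d, a) pderiv b' (christoffel G a c' d) x)
         + christoffel_mx c' x *m christoffel_mx b' x).
  by rewrite pE; exact: block_row_mul.
have key b' c' d a : (\matrix_(d, a) pderiv b' (christoffel G a c' d) x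
      + christoffel_mx c' x *m christoffel_mx b' x) d a =
    pderiv b' (christoffel G a c' d) x +
    \sum_e christoffel G a b' e x * christoffel G e c' d x.
  rewrite mxE mxE [X in _ + X]mxE; congr (_ + _).
  by apply: eq_bigr => e _; rewrite mxE mxE mulrC.
have rows : (delta_mx 0 c : 'rV[R]_n) *m christoffel_mx b x =
    (delta_mx 0 b : 'rV[R]_n) *m christoffel_mx c x.
  rewrite -!rowE; apply/matrixP => i a; rewrite mxE mxE mxE mxE.
  exact: (christoffel_sym oU symG _ _ _ Ux).
have alg (s1 s2 s3 s4 : R) : s1 - s2 + (s3 - s4) = 0 -> s1 + s3 = s2 + s4 by lra.
have blocks : (\matrix_(d, a) pderiv b (christoffel G a c d) x)
      + christoffel_mx c x *m christoffel_mx b x =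
    (\matrix_(d, a) pderiv c (christoffel G a b d) x)
      + christoffel_mx b x *m christoffel_mx c x.
  apply/matrixP => d a; rewrite (key b c d a) (key c b d a).
  have := flatG Ux a d b c; rewrite /curvature.
  rewrite big_split sumrN /=; exact: alg.
apply: etrans (mE b c) (etrans _ (esym (mE c b))).
exact: (f_equal2 (fun u C => block_mx 0 u 0 C) rows blocks).
Qed.

(** Flatness extends every covector at [x0] to a parallel one-form, which is
    closed since the connection is symmetric; [v] is its potential. *)
Lemma parallel_differential : exists r, [/\ 0 < r, forall p, `|p - x0| < r -> U p &
  forall w0 : 'I_n -> R, exists v : 'rV[R]_n -> R,
    [/\ smooth_on [set p | `|p - x0| < r] v,
      forall c, pderiv c v x0 = w0 c &
      forall p, `|p - x0| < r -> forall b c,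
        pderiv b (pderiv c v) p = \sum_a christoffel G a b c p * pderiv a v p]].
Proof.
have [r [r0 rU H]] := frobenius oU Ux0 smooth_hessian_system hessian_system_integrable.
exists r; split=> // w0.
have [y [y0 sy]] := H (col_mx 0 (\col_c w0 c)).
pose v p := y p (lshift n 0) 0.
have oB := @open_norm_ball R n x0 r.
have Bx0 : `|x0 - x0| < r by rewrite subrr normr0.
have sv : smooth_on [set p | `|p - x0| < r] v.
  apply: solves_smooth sy _ => // b i j.
  exact: smooth_sub (smooth_hessian_system b i j).
have vE p c : `|p - x0| < r -> pderiv c v p = y p (rshift 1 c) 0.
  move=> pr; have [_ ->] := sy p pr (lshift n 0).
  rewrite /hessian_system -[y p]vsubmxK mul_block_col col_mxEu mul0mx add0r -rowE.
  by rewrite mxE col_mxEd.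
exists v; split=> // [c|p pr b c].
  by rewrite vE // y0 col_mxEd mxE.
have -> : pderiv b (pderiv c v) p = pderiv b (fun q => y q (rshift 1 c) 0) p.
  by apply: pderiv_near; apply: near_open oB pr _ => q qr; exact: vE.
have [_ ->] := sy p pr (rshift 1 c).
rewrite /hessian_system -{1}[y p]vsubmxK mul_block_col col_mxEd mul0mx add0r mxE.
by apply: eq_bigr => a _; rewrite vE // mxE [X in _ * X]mxE.
Qed.

(** The coordinates have parallel differentials that are orthonormal at [x0].
    They remain so: the difference [w] between the form that they induce and [G]
    solves a homogeneous linear system, as the connection is metric. *)
Theorem flat_coordinates : exists r, [/\ 0 < r, forall p, `|p - x0| < r -> U p &
  exists v : 'I_n -> 'rV[R]_n -> R,
    (forall t, smooth_on [set p | `|p - x0| < r] (v t)) /\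
    forall p, `|p - x0| < r -> forall a b,
      \sum_t pderiv a (v t) p * pderiv b (v t) p = G p a b].
Proof.
have [E EE] : exists E : 'M[R]_n, E^T *m E = G x0.
  apply: gram_exists (pG Ux0); apply/matrixP => a b.
  by rewrite mxE symG.
have [r [r0 rU H]] := parallel_differential.
have /choice[v vP] := fun t => H (E t).
have dv t a p : `|p - x0| < r -> differentiable (pderiv a (v t)) p.
  by move=> pr; have [sv _ _] := vP t; exact: smooth_diff (smooth_pderiv a sv) pr.
have dG a b p : `|p - x0| < r -> differentiable (fun q => G q a b) p.
  by move=> pr; exact: smooth_diff (sG a b) (rU p pr).
pose w (ab : 'I_n * 'I_n) p :=
  \sum_t pderiv ab.1 (v t) p * pderiv ab.2 (v t) p - G p ab.1 ab.2.
have dsum a b p : `|p - x0| < r ->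
    differentiable (fun q => \sum_t pderiv a (v t) q * pderiv b (v t) q) p.
  by move=> pr; apply: diff_sum => t; apply: differentiableM; exact: dv.
have pw c ab p : `|p - x0| < r -> pderiv c (w ab) p =
    \sum_e (christoffel G e c ab.1 p * w (e, ab.2) p +
            christoffel G e c ab.2 p * w (ab.1, e) p).
  move=> pr; rewrite /w pderivB; [|exact: dsum|exact: dG].
  rewrite (pderiv_metric oU symG uG _ _ _ (rU p pr)).
  pose S a b := \sum_t pderiv a (v t) p * pderiv b (v t) p.
  have -> : pderiv c (fun q => \sum_t pderiv ab.1 (v t) q * pderiv ab.2 (v t) q) p =
      \sum_e (christoffel G e c ab.1 p * S e ab.2 + christoffel G e c ab.2 p * S ab.1 e).
    rewrite pderiv_sum => [|t]; last by apply: differentiableM; exact: dv.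
    under [RHS]eq_bigr do rewrite /S !mulr_sumr -big_split /=.
    rewrite exchange_big; apply: eq_bigr => t _ /=.
    have [_ _ hess] := vP t.
    rewrite pderivM; [|exact: dv..].
    rewrite !hess // mulr_suml mulr_sumr -big_split.
    by apply: eq_bigr => e _ /=; ring.
  by rewrite -sumrB; apply: eq_bigr => e _; rewrite /S /=; ring.
have [M [M0 MB]] : exists M, 0 < M /\
    forall e b c y, `|y - x0| < M^-1 -> `|christoffel G e b c y| <= M.
  apply: (@filter_ex _ (+oo : set_system R)); near=> M; split; near: M.
    exact: (nbhs_pinfty_gt (num_real _)).
  apply: filter_forall => e; apply: filter_forall => b; apply: filter_forall => c.
  exact: near_bounded (smooth_christoffel oU sG uG e b c 0%N x0 Ux0).
pose r' := Num.min r M^-1.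
have r'0 : 0 < r' by rewrite lt_min r0 invr_gt0.
have K0 : 0 <= n%:R * (M + M) by rewrite mulr_ge0 // addr_ge0 // ltW.
have [rho [rho0 rhor w0]] : exists rho, [/\ 0 < rho, rho <= r' &
    forall p, `|p - x0| < rho -> forall ab, w ab p = 0].
  apply: (vanish_near (w := w) r'0 K0).
  - move=> p; rewrite lt_min => /andP[pr _] ab.
    by apply: differentiableB; [exact: dsum|exact: dG].
  - move=> p L; rewrite lt_min => /andP[pr pM] wL c ab.
    rewrite pw //; apply: le_trans (ler_norm_sum _ _ _) _.
    have -> : n%:R * (M + M) * L = \sum_(e < n) (M * L + M * L).
      by rewrite sumr_const card_ord -mulr_natl; ring.
    apply: ler_sum => e _; apply: le_trans (ler_normD _ _) _.
    by apply: lerD; rewrite normrM; apply: ler_pM => //; exact: MB.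
  - move=> [a b]; rewrite /w /= -EE mxE; apply/eqP; rewrite subr_eq0; apply/eqP.
    by apply: eq_bigr => t _; have [_ h _] := vP t; rewrite !h mxE.
have rr : rho <= r by rewrite (le_trans rhor) // ge_min lexx.
exists rho; split=> // [p pr|]; first by apply: rU; exact: lt_le_trans rr.
exists v; split=> [t|p pr a b].
  have [sv _ _] := vP t; apply: smooth_sub sv => p /= pr.
  exact: lt_le_trans rr.
by apply/eqP; rewrite -subr_eq0; apply/eqP; exact: (w0 p pr (a, b)).
Unshelve. all: by end_near. Qed.

End FlatCoordinates.

(** * Flatness of induced metrics *)

Section GramMetricFlat.
Context {R : realType} {n : nat}.
Variables (G : 'rV[R]_n -> 'M[R]_n) (U : set 'rV[R]_n) (u : 'I_n -> 'rV[R]_n -> R).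
Hypothesis oU : open U.
Hypothesis su : forall t, smooth_on U (u t).
Hypothesis GE : forall x, U x -> forall a b,
  G x a b = \sum_t pderiv a (u t) x * pderiv b (u t) x.

Definition jacobian_mx x : 'M[R]_n := \matrix_(t, a) pderiv a (u t) x.

Hypothesis uJ : forall x, U x -> jacobian_mx x \in unitmx.

Let GJ x : U x -> G x = (jacobian_mx x)^T *m jacobian_mx x.
Proof.
move=> Ux; apply/matrixP => a b; rewrite GE // mxE.
by apply: eq_bigr => t _; rewrite !mxE.
Qed.

Let uG x : U x -> G x \in unitmx.
Proof. by move=> Ux; rewrite GJ // unitmx_mul unitmx_tr uJ. Qed.

Let symG x : U x -> forall a b, G x a b = G x b a.
Proof. by move=> Ux a b; rewrite !GE //; apply: eq_bigr => t _; rewrite mulrC. Qed.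

Let spu a t : smooth_on U (pderiv a (u t)).
Proof. exact: smooth_pderiv. Qed.

Let dpu a t x : U x -> differentiable (pderiv a (u t)) x.
Proof. by move=> Ux; exact: smooth_diff (spu a t) Ux. Qed.

Let sG a b : smooth_on U (fun x => G x a b).
Proof.
apply: (@smooth_ext _ _ _ oU (fun x => \sum_t pderiv a (u t) x * pderiv b (u t) x)).
  by move=> x Ux; rewrite GE.
by apply: smooth_sum => // t; apply: smoothM.
Qed.

Lemma pderiv_gram x a b c : U x -> pderiv c (fun y => G y a b) x =
  \sum_t (pderiv c (pderiv a (u t)) x * pderiv b (u t) x +
          pderiv a (u t) x * pderiv c (pderiv b (u t)) x).
Proof.
move=> Ux.
have -> : pderiv c (fun y => G y a b) x =
    pderiv c (fun y => \sum_t pderiv a (u t) y * pderiv b (u t) y) x.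
  by apply: pderiv_near; apply: near_open oU Ux _ => y Uy; rewrite GE.
rewrite pderiv_sum => [|t]; last by apply: differentiableM; exact: dpu.
by apply: eq_bigr => t _; rewrite pderivM //; exact: dpu.
Qed.

Lemma jacobian_inj x (w : 'I_n -> R) : U x ->
  (forall t, \sum_a pderiv a (u t) x * w a = 0) -> forall a, w a = 0.
Proof.
move=> Ux w0.
have : jacobian_mx x *m (\col_a w a) = 0.
  apply/matrixP => t j; rewrite !mxE -[RHS](w0 t).
  by apply: eq_bigr => a _; rewrite !mxE.
move=> /(congr1 (mulmx (invmx (jacobian_mx x)))); rewrite mulKmx ?uJ // mulmx0.
by move=> /matrixP h a; have := h a 0; rewrite !mxE.
Qed.

(** In the coordinates [u] the connection vanishes, so in the given ones it is
    expressed by second derivatives of [u]. *)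
Lemma christoffel_gram x t b c : U x ->
  \sum_a pderiv a (u t) x * christoffel G a b c x = pderiv b (pderiv c (u t)) x.
Proof.
move=> Ux.
pose w t := \sum_a pderiv a (u t) x * christoffel G a b c x
            - pderiv b (pderiv c (u t)) x.
suff h : forall s, w s = 0 by apply/eqP; rewrite -subr_eq0; apply/eqP; exact: h.
have low e : \sum_s pderiv e (u s) x * w s = 0.
  have L := lower_christoffel uG e b c Ux.
  have -> : \sum_s pderiv e (u s) x * w s =
      \sum_a G x e a * christoffel G a b c x -
      \sum_s pderiv e (u s) x * pderiv b (pderiv c (u s)) x.
    under [X in _ = X - _]eq_bigr do rewrite GE // mulr_suml.
    rewrite exchange_big -sumrB; apply: eq_bigr => s _ /=.
    rewrite /w mulrBr mulr_sumr; congr (_ - _).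
    by apply: eq_bigr => a _; rewrite mulrA.
  rewrite L !pderiv_gram // -big_split -sumrB mulr_sumr -sumrB big1 // => s _ /=.
  have alg (p q r pq pr qp rp qr rq : R) : pq = qp -> pr = rp -> rq = qr ->
      2^-1 * (qp * r + p * qr + (rp * q + p * rq) - (pq * r + q * pr)) - p * qr = 0.
    by move=> -> -> ->; field.
  by apply: alg; exact: pderivC oU (su s) Ux.
have : (jacobian_mx x)^T *m (\col_s w s) = 0.
  apply/matrixP => e j; rewrite !mxE -[RHS](low e).
  by apply: eq_bigr => a _; rewrite !mxE.
move=> /(congr1 (mulmx (invmx (jacobian_mx x)^T))).
rewrite mulKmx ?unitmx_tr ?uJ // mulmx0.
by move=> /matrixP h s; have := h s 0; rewrite !mxE.
Qed.

(** Differentiating [christoffel_gram] once more gives an expression of the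
    third derivatives of [u]; its part antisymmetric in the first two indices is
    the curvature multiplied by the invertible jacobian. *)
Theorem gram_flat x : U x -> forall a b c d, curvature G a b c d x = 0.
Proof.
move=> Ux a b c d; move: a; apply: (@jacobian_inj x _ Ux) => t.
have sC a' b' c' : smooth_on U (christoffel G a' b' c') by exact: smooth_christoffel.
have third c' d' : pderiv c' (pderiv d' (pderiv b (u t))) x =
    \sum_a pderiv a (u t) x * (pderiv c' (christoffel G a d' b) x +
      \sum_e christoffel G a c' e x * christoffel G e d' b x).
  have -> : pderiv c' (pderiv d' (pderiv b (u t))) x =
      pderiv c' (fun y => \sum_a pderiv a (u t) y * christoffel G a d' b y) x.
    apply: pderiv_near; apply: near_open oU Ux _ => y Uy.
    by rewrite christoffel_gram.
  have dC a' b' c'' : differentiable (christoffel G a' b' c'') x.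
    exact: smooth_diff (sC _ _ _) Ux.
  rewrite pderiv_sum => [|a]; last by apply: differentiableM => //; exact: dpu.
  transitivity (\sum_a ((\sum_e pderiv e (u t) x * christoffel G e c' a x)
      * christoffel G a d' b x + pderiv a (u t) x * pderiv c' (christoffel G a d' b) x)).
    apply: eq_bigr => a _; rewrite pderivM; [|exact: dpu|exact: dC].
    by rewrite christoffel_gram.
  rewrite big_split /= addrC.
  under [RHS]eq_bigr do rewrite mulrDr; rewrite big_split /=; congr (_ + _).
  under eq_bigr do rewrite mulr_suml; rewrite exchange_big; apply: eq_bigr => e _ /=.
  by rewrite mulr_sumr; apply: eq_bigr => e' _; rewrite mulrA.
have := pderivC c d oU (spu b t) Ux; rewrite !third => E.
apply: etrans (_ : _ = _ - _) (etrans (congr1 (fun z => z - _) E) (subrr _)).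
rewrite -sumrB; apply: eq_bigr => a _; rewrite /curvature -mulrBr sumrB.
congr (_ * _); rewrite opprD !addrA; congr (_ - _); by rewrite addrAC.
Qed.

End GramMetricFlat.

(** * Change of charts *)

Lemma open_local (T : topologicalType) (A : set T) :
  (forall x, A x -> \forall y \near x, A y) -> open A.
Proof. by move=> H; rewrite openE => x /H. Qed.

Section Charts.
Context {R : realType} {n : nat} (M : manifold R n).
Implicit Types (i j : atlas_index M) (x : 'rV[R]_n) (W : set M) (u : M -> R).

Lemma chart_image_open i W : open W -> open (chart_image (atlas i) W).
Proof.
move=> oW; apply: open_local => x [cx Wx].
have h1 : \forall y \near x, ccod (atlas i) y.
  by apply: (near_open (@ccod_open _ _ _ (atlas i)) cx) => y.
have h2 : \forall y \near x, W (cinv (atlas i) y).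
  by apply: cinv_continuous => //; exact: open_nbhs_nbhs.
exact: filterS2 h1 h2.
Qed.

Lemma chart_preimage_open i (V : set 'rV[R]_n) : open V ->
  open (cdom (atlas i) `&` cmap (atlas i) @^-1` V).
Proof.
move=> oV; apply: open_local => x [cx Wx].
have h1 : \forall y \near x, cdom (atlas i) y.
  by apply: (near_open (@cdom_open _ _ _ (atlas i)) cx) => y.
have h2 : \forall y \near x, V (cmap (atlas i) y).
  by apply: cmap_continuous => //; exact: open_nbhs_nbhs.
exact: filterS2 h1 h2.
Qed.

Lemma chart_image_sub i W W' : W `<=` W' ->
  chart_image (atlas i) W `<=` chart_image (atlas i) W'.
Proof. by move=> WW' x [cx Wx]; split=> //; exact: WW'. Qed.

(** The change of coordinates as a map of vectors, so that the chain rule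
    applies; [transition] gives its components. *)
Definition recoord i j x : 'rV[R]_n := cmap (atlas j) (cinv (atlas i) x).

Lemma recoord_smooth i j k : smooth_on (chart_image (atlas i) (cdom (atlas j)))
  (fun x => recoord i j x 0 k).
Proof. exact: atlas_smooth. Qed.

Lemma recoord_image i j W x : chart_image (atlas i) (W `&` cdom (atlas j)) x ->
  chart_image (atlas j) W (recoord i j x).
Proof.
move=> [cx [Wx dx]]; split; first exact: cmap_cod.
by rewrite /preimage /= /recoord cmapK.
Qed.

Lemma scalar_recoord u i j x : cdom (atlas j) (cinv (atlas i) x) ->
  u (cinv (atlas i) x) = (u \o cinv (atlas j)) (recoord i j x).
Proof. by move=> dx; rewrite /= /recoord cmapK. Qed.

Lemma smooth_recoord i j W V (f : 'rV[R]_n -> R) : open W -> W `<=` cdom (atlas j) ->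
  (forall x, chart_image (atlas i) W x -> V (recoord i j x)) ->
  smooth_on V f -> smooth_on (chart_image (atlas i) W) (f \o recoord i j).
Proof.
move=> oW Wd WV sf; apply: (smooth_comp (V := V)) => //.
  exact: chart_image_open.
by move=> k; apply: smooth_sub (recoord_smooth i j k); exact: chart_image_sub.
Qed.

Lemma pderiv_recoord (f : 'rV[R]_n -> R) i j x a :
  chart_image (atlas i) (cdom (atlas j)) x -> differentiable f (recoord i j x) ->
  pderiv a (f \o recoord i j) x = \sum_k pderiv k f (recoord i j x) *
     pderiv a (transition (atlas i) (atlas j) k) x.
Proof.
move=> cx df; rewrite pderiv_comp // => k.
exact: smooth_diff (recoord_smooth i j k) cx.
Qed.

(** A differential transforms covariantly. *)
Lemma dscalar_recoord W u i j x a : open W -> smooth_scalar_on W u ->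
  chart_image (atlas i) (W `&` cdom (atlas j)) x ->
  dscalar u i x a = \sum_k dscalar u j (recoord i j x) k *
     pderiv a (transition (atlas i) (atlas j) k) x.
Proof.
move=> oW su Wx.
have dx : chart_image (atlas i) (cdom (atlas j)) x.
  by apply: chart_image_sub Wx => p [].
rewrite /dscalar -pderiv_recoord //.
  have oC := chart_image_open (i := i) (@cdom_open _ _ _ (atlas j)).
  apply: pderiv_near; apply: near_open oC dx _ => y [_ dy].
  exact: scalar_recoord.
exact: smooth_diff (su j) (recoord_image Wx).
Qed.

(** The pullback of the Euclidean metric by the map with components [u]. *)
Definition square_sum m (u : 'I_m -> M -> R) : components2 M :=
  fun i x => \matrix_(a, b) \sum_t dscalar (u t) i x a * dscalar (u t) i x b.

Lemma square_sum_tensorial m (u : 'I_m -> M -> R) W : open W ->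
  (forall t, smooth_scalar_on W (u t)) -> tensorial_on W (square_sum u).
Proof.
move=> oW su i j x Wx a b; rewrite mxE.
pose q k := pderiv a (transition (atlas i) (atlas j) k) x.
pose q' k := pderiv b (transition (atlas i) (atlas j) k) x.
pose d t k := dscalar (u t) j (recoord i j x) k.
transitivity (\sum_t \sum_k \sum_l d t k * d t l * q k * q' l).
  apply: eq_bigr => t _.
  rewrite (dscalar_recoord _ oW (su t) Wx) (dscalar_recoord b oW (su t) Wx).
  rewrite mulr_suml; apply: eq_bigr => k _.
  by rewrite mulr_sumr; apply: eq_bigr => l _; rewrite /d /q /q'; ring.
rewrite exchange_big; apply: eq_bigr => k _ /=.
rewrite exchange_big; apply: eq_bigr => l _ /=.
by rewrite mxE !mulr_suml.
Qed.

Lemma smooth_dscalar W u i a : smooth_scalar_on W u ->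
  smooth_on (chart_image (atlas i) W) (fun x => dscalar u i x a).
Proof. by move=> su; exact: smooth_pderiv. Qed.

Lemma smooth_scalar_sub W W' u : W' `<=` W -> smooth_scalar_on W u ->
  smooth_scalar_on W' u.
Proof. by move=> WW su i; apply: smooth_sub (su i); exact: chart_image_sub. Qed.

End Charts.

(** * Immersions and reduced metrics *)

(** The complementary injection is stated through sums, which is how the two
    parts of the immersion are separated. *)
Lemma complement_ord n k (s : 'I_n -> 'I_(n + k)) : injective s ->
  exists c : 'I_k -> 'I_(n + k), forall (V : nmodType) (F : 'I_(n + k) -> V),
    \sum_t F t = \sum_i F (s i) + \sum_j F (c j).
Proof.
move=> inj_s; pose C := ~: [set s i | i : 'I_n].
have cC : #|C| = k.
  have := cardsC [set s i | i : 'I_n]; rewrite card_imset // !card_ord -/C.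
  exact: addnI.
exists (fun j => enum_val (cast_ord (esym cC) j)) => V F.
rewrite (bigID (mem [set s i | i : 'I_n])) /=; congr (_ + _).
  by rewrite big_imset //=; move=> i j _ _; exact: inj_s.
rewrite (eq_bigl (mem C)) => [|t]; last by rewrite /= finset.in_setC.
rewrite big_enum_val (reindex (cast_ord (esym cC))) //=.
exists (cast_ord cC) => j _; exact/val_inj.
Qed.

Section Correspondence.
Context {R : realType} {n k : nat} (M : manifold R n) (g : components2 M).
Hypothesis g_metric : riemannian_metric_on setT g.

Definition reduced_metric (h : 'I_k -> M -> R) : components2 M :=
  fun i x => \matrix_(a < n, b < n)
    (g i x a b - \sum_(t < k) dscalar (h t) i x a * dscalar (h t) i x b).

(** The immersion consists of flat coordinates [v] of the reduced metric in one
    chart, followed by [h]; tensoriality carries its equation to the other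
    charts. *)
Lemma immersion_of_flat (W : set M) (h : 'I_k -> M -> R) (p : M) :
  open W -> W p -> (forall t, smooth_scalar_on W (h t)) ->
  flat_riemannian_metric_on W (reduced_metric h) ->
  exists W' : set M, [/\ open W', W' p &
    exists u : 'I_(n + k) -> M -> R,
      (forall t, smooth_scalar_on W' (u t)) /\
      (forall i x, chart_image (atlas i) W' x -> forall a b : 'I_n,
         \sum_(t < n + k) dscalar (u t) i x a * dscalar (u t) i x b
         = g i x a b)].
Proof.
move=> oW Wp sh [[tf sf symf pf] ff].
have [i0 dp] := atlas_cover p.
pose x0 := cmap (atlas i0) p.
have Ux0 : chart_image (atlas i0) W x0.
  by split; [exact: cmap_cod | rewrite /preimage /= cmapK].
have oU := chart_image_open (i := i0) oW.
have [r [r0 rU [v [sv vE]]]] :=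
  flat_coordinates oU Ux0 (sf i0) (symf i0) (pf i0) (ff i0).
pose V := [set x : 'rV[R]_n | `|x - x0| < r].
have oV : open V by exact: open_norm_ball.
pose W' := W `&` (cdom (atlas i0) `&` cmap (atlas i0) @^-1` V).
have oW' : open W' by apply: openI => //; exact: chart_preimage_open.
have W'W : W' `<=` W by move=> q [].
have W'd : W' `<=` cdom (atlas i0) by move=> q [_ []].
have W'V i x : chart_image (atlas i) W' x -> V (recoord i i0 x) by move=> [_ [_ []]].
exists W'; split=> //.
  by split=> //; split=> //; rewrite /preimage /V /= subrr normr0.
pose u t := match fintype.split t with
            | inl s => v s \o cmap (atlas i0)
            | inr s => h s end.
have uv s : u (lshift k s) = v s \o cmap (atlas i0).
  by rewrite /u; have := fintype.unsplitK (inl s : 'I_n + 'I_k); rewrite /= => ->.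
have uh s : u (rshift n s) = h s.
  by rewrite /u; have := fintype.unsplitK (inr s : 'I_n + 'I_k); rewrite /= => ->.
exists u; split=> [t|i x xW a b].
  rewrite -(fintype.splitK t); case: (fintype.split t) => s /=.
    by rewrite uv => i; exact: (smooth_recoord oW' W'd (W'V i) (sv s)).
  by rewrite uh; exact: (smooth_scalar_sub W'W (sh s)).
rewrite big_split_ord /=.
under [X in X + _ = _]eq_bigr do rewrite uv.
under [X in _ + X = _]eq_bigr do rewrite uh.
have xd : chart_image (atlas i) (cdom (atlas i0)) x by exact: chart_image_sub xW.
have dv s c : dscalar (v s \o cmap (atlas i0)) i x c =
    \sum_l pderiv l (v s) (recoord i i0 x) *
      pderiv c (transition (atlas i) (atlas i0) l) x.
  by apply: pderiv_recoord xd _; exact: smooth_diff (sv s) (W'V _ _ xW).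
have xWd : chart_image (atlas i) (W `&` cdom (atlas i0)) x.
  by apply: chart_image_sub xW => q Wq; split; [exact: W'W | exact: W'd].
suff -> : \sum_s dscalar (v s \o cmap (atlas i0)) i x a *
                 dscalar (v s \o cmap (atlas i0)) i x b = reduced_metric h i x a b.
  by rewrite mxE subrK.
rewrite (tf i i0 x xWd a b).
pose q c l := pderiv c (transition (atlas i) (atlas i0) l) x.
pose e s l := pderiv l (v s) (recoord i i0 x).
transitivity (\sum_s \sum_l \sum_m e s l * e s m * q a l * q b m).
  apply: eq_bigr => s _; rewrite !dv mulr_suml; apply: eq_bigr => l _.
  by rewrite mulr_sumr; apply: eq_bigr => m _; rewrite /e /q; ring.
rewrite exchange_big; apply: eq_bigr => l _ /=.
rewrite exchange_big; apply: eq_bigr => m _ /=.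
by rewrite -!mulr_suml /e vE //; exact: W'V.
Qed.

(** Since [g] is nondegenerate, some [n] of the [n + k] functions have
    independent differentials at [p], hence near [p]. The metric that they induce
    is flat, and it is what the remaining functions leave of [g]. *)
Lemma flat_of_immersion (W : set M) (u : 'I_(n + k) -> M -> R) (p : M) :
  open W -> W p -> (forall t, smooth_scalar_on W (u t)) ->
  (forall i x, chart_image (atlas i) W x -> forall a b : 'I_n,
     \sum_(t < n + k) dscalar (u t) i x a * dscalar (u t) i x b = g i x a b) ->
  exists W' : set M, [/\ open W', W' p &
    exists h : 'I_k -> M -> R,
      (forall t, smooth_scalar_on W' (h t)) /\
      flat_riemannian_metric_on W' (reduced_metric h)].
Proof.
move=> oW Wp su uE; have [tg sg symg pg] := g_metric.
have [i0 dp] := atlas_cover p.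
pose x0 := cmap (atlas i0) p.
pose U := chart_image (atlas i0) W.
have Ux0 : U x0 by split; [exact: cmap_cod | rewrite /preimage /= cmapK].
have oU : open U by exact: chart_image_open.
pose J : 'M[R]_(n + k, n) := \matrix_(t, a) dscalar (u t) i0 x0 a.
have pJ : posdef (J^T *m J).
  move=> w w0; have -> : J^T *m J = g i0 x0.
    apply/matrixP => a b; rewrite -uE // mxE.
    by apply: eq_bigr => t _; rewrite !mxE.
  by apply: pg => //; case: Ux0.
have rJ : row_full J.
  rewrite -col_leq_rank -[X in (X <= _)%N](mxrank_unit (posdef_unitmx pJ)).
  exact: mxrankM_maxr.
pose s := fullrankfun rJ.
have [c split_s] := complement_ord (fullrankfun_inj (rkA := rJ)).
pose us t := u (s t).
pose Jac i x : 'M[R]_n := \matrix_(t, a) dscalar (us t) i x a.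
(* Independence is tested in the chart [i0] only; the chain rule extends it to
   every other chart in [uJ]. *)
pose V := U `&` [set x | \det (Jac i0 x) != 0].
have Vx0 : V x0.
  split=> //=; rewrite -unitfE -unitmxE.
  have -> : Jac i0 x0 = rowsub s J by apply/matrixP => t a; rewrite !mxE.
  exact: fullrowsub_unit.
have oV : open V.
  have sdet : smooth_on U (fun x => \det (Jac i0 x)).
    apply: smooth_det => // t a; under eq_fun do rewrite mxE.
    by apply: (@smooth_dscalar _ _ _ W); exact: su.
  apply: open_local => x [Ux dx].
  have h1 : \forall y \near x, U y by apply: near_open oU Ux _.
  have h2 : \forall y \near x, \det (Jac i0 y) != 0.
    exact: cvgr_neq0 (sdet 0%N x Ux) dx.
  exact: filterS2 h1 h2.
pose W' := W `&` (cdom (atlas i0) `&` cmap (atlas i0) @^-1` V).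
have oW' : open W' by apply: openI => //; exact: chart_preimage_open.
have W'W : W' `<=` W by move=> q [].
exists W'; split=> //.
exists (fun t => u (c t)).
have suW t : smooth_scalar_on W' (u t) by exact: (smooth_scalar_sub W'W (su t)).
split=> //.
have fE i x : chart_image (atlas i) W' x -> forall a b,
    reduced_metric (fun t => u (c t)) i x a b =
    \sum_t dscalar (us t) i x a * dscalar (us t) i x b.
  move=> xW a b; rewrite mxE -uE; last exact: chart_image_sub W'W _ xW.
  by rewrite (split_s _ (fun t => dscalar (u t) i x a * dscalar (u t) i x b)) addrK.
have uJ i x : chart_image (atlas i) W' x -> Jac i x \in unitmx.
  move=> xW.
  have [_ Vy] : V (recoord i i0 x) by case: xW => _ [_ []].
  have [cx [Wx [dx _]]] := xW.
  pose y := recoord i i0 x.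
  have yx : recoord i0 i y = x by rewrite /y /recoord cmapK // cinvK.
  have yW : chart_image (atlas i0) (W `&` cdom (atlas i)) y.
    split; first exact: cmap_cod.
    by rewrite /y /preimage /= /recoord cmapK //; split=> //; exact: cinv_dom.
  pose T : 'M[R]_n := \matrix_(l, a) pderiv a (transition (atlas i0) (atlas i) l) y.
  have : Jac i0 y = Jac i x *m T.
    apply/matrixP => t a; rewrite !mxE (dscalar_recoord a oW (su (s t)) yW) yx.
    by apply: eq_bigr => l _; rewrite !mxE.
  move=> /(congr1 determinant) E; move: Vy; rewrite /= -/y E det_mulmx mulf_eq0.
  by rewrite negb_or unitmxE unitfE => /andP[].
have JE i x : chart_image (atlas i) W' x ->
    reduced_metric (fun t => u (c t)) i x = (Jac i x)^T *m Jac i x.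
  move=> xW; apply/matrixP => a b; rewrite fE // mxE.
  by apply: eq_bigr => t _; rewrite !mxE.
split; last first.
  move=> i x xW; apply: (gram_flat (chart_image_open (i := i) oW')
      (u := fun t => us t \o cinv (atlas i)) _ (fE i) _ xW).
    by move=> t; exact: suW.
  exact: uJ.
split.
- move=> i j x xW a b.
  have xT : chart_image (atlas i) (setT `&` cdom (atlas j)) x.
    by apply: chart_image_sub xW => q [].
  rewrite mxE (tg i j x xT a b).
  have := square_sum_tensorial oW' (fun t => suW (c t)) xW a b.
  rewrite mxE => ->; rewrite -sumrB; apply: eq_bigr => l _.
  rewrite -sumrB; apply: eq_bigr => m _.
  rewrite !mxE; ring.
- move=> i a b; under eq_fun do rewrite mxE.
  have oC := chart_image_open (i := i) oW'.
  apply: smoothB => //.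
    by apply: smooth_sub (sg i a b); exact: chart_image_sub.
  apply: smooth_sum => // t; apply: smoothM => //; apply: smooth_dscalar; exact: suW.
- move=> i x xW a b; rewrite !fE //.
  by apply: eq_bigr => t _; rewrite mulrC.
- move=> i x xW w w0; have := posdef_gram (uJ i x xW) w0.
  by rewrite -JE.
Qed.

End Correspondence.

Theorem lemma2p2 (R : realType) (n k : nat) (M : manifold R n)
    (g : components2 M) (g_metric : riemannian_metric_on setT g) :
  local_isometric_immersion g (n + k) <->
  (forall p : M, exists W : set M, [/\ open W, W p &
     exists h : 'I_k -> M -> R,
       (forall t, smooth_scalar_on W (h t)) /\
       flat_riemannian_metric_on W
         (fun (i : atlas_index M) (x : 'rV[R]_n) =>
            \matrix_(a < n, b < n)
              (g i x a b -
               \sum_(t < k) dscalar (h t) i x a * dscalar (h t) i x b))]).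
Proof.
split=> H p; have [W [oW Wp]] := H p.
- by move=> [u [su uE]]; exact: flat_of_immersion oW Wp su uE.
- by move=> [h [sh fh]]; exact: immersion_of_flat oW Wp sh fh.
Qed.
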